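(* Let $\mathcal{T}\in\wedge^d\mathrm{W}\simeq\wedge^d\mathbb{F}^m$ be a generic skew-symmetric tensor of Grassmann rank $r$ with $m\ge dr$ and $d\ge3$. Then the Grassmann decomposition algorithm described in the context, applied to $\mathcal{T}$, computes a set of elementary skew-symmetric tensors decomposing $\mathcal{T}$; that is, with $U$, $\mathbf{v}_i^k$ and $x_i$ as computed by the algorithm, $$\mathcal{T}=\sum_{i=1}^r x_i\,(U\mathbf{v}_i^1)\wedge\dots\wedge(U\mathbf{v}_i^d).$$
   Context: $\mathbb{F}$ is $\mathbb{R}$ or $\mathbb{C}$. The wedge product is $\mathbf{v}_1\wedge\dots\wedge\mathbf{v}_d:=\frac{1}{d!}\sum_{\sigma\in\mathfrak{S}([d])}\mathrm{sign}(\sigma)\,\mathbf{v}_{\sigma(1)}\otimes\dots\otimes\mathbf{v}_{\sigma(d)}$; such tensors are called elementary skew-symmetric tensors, and $\wedge^d\mathrm{W}\subset\mathrm{W}^{\otimes d}$ is their linear span. The Grassmann rank of a tensor in $\wedge^d\mathrm{W}$ is the smallest $r$ such that it is a sum of $r$ elementary skew-symmetric tensors. A property of elements of an irreducible variety is generic if it fails at most on a strict Zariski closed subset; a generic skew-symmetric tensor of Grassmann rank $r$ is generic in this sense in the Zariski closure of the set of sums of $r$ elementary skew-symmetric tensors. Generic elements of a vector space are understood likewise. Notation: $(A_1,\dots,A_d)\cdot\mathcal{T}:=(A_1\otimes\dots\otimes A_d)(\mathcal{T})$ for linear maps $A_k$; $A\cdot_k\mathcal{T}$ applies $A$ in the $k$th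 factor and the identity in all others. $\mathcal{T}_{(1)}$ is the first standard flattening, i.e. the image of $\mathcal{T}$ under the linear map $\mathrm{W}^{\otimes d}\to\mathrm{W}\otimes(\mathrm{W}^{\otimes(d-1)})^*$, $\mathbf{w}_1\otimes\dots\otimes\mathbf{w}_d\mapsto\mathbf{w}_1(\mathbf{w}_2\otimes\dots\otimes\mathbf{w}_d)^{T}$. $U^{H}$ is the conjugate transpose. The algorithm (in exact arithmetic), on input $\mathcal{T}\in\wedge^d\mathrm{W}$ of Grassmann rank $r\le\frac1d\dim\mathrm{W}$: (S0) Compute a matrix $U\in\mathbb{F}^{m\times dr}$ whose columns form an orthonormal basis of the column span of $\mathcal{T}_{(1)}$, and $\mathcal{A}=(U^{H},\dots,U^{H})\cdot\mathcal{T}\in\wedge^d\mathbb{F}^{dr}$. (S1) Compute the matrix $J$ of the linear map $\delta_{\mathcal{A}}:\mathbb{F}^{dr\times dr}\to\wedge^d\mathbb{F}^{dr}$, $\dot{X}\mapsto\sum_{k=1}^d\dot{X}\cdot_k\mathcal{A}$. (S2) Compute the kernel $\kappa_{\mathcal{A}}$ of $J$. (S3) Choose a generic matrix $K\in\kappa_{\mathcal{A}}$ and compute an eigenvalue decomposition $K=W\Lambda W^{-1}$ (over $\mathbb{C}$ if necessary). (S4) Choose a generic matrix $K'\in\kappa_{\mathcal{A}}$ and compute a permutation matrix $P$ such that $P^{T}W^{-1}K'WP$ is a block diagonal matrix (with $r$ diagonal blocks of size $d\times d$). (S5) Partition $WP=[V_1\ \cdots\ V_r]$ with $V_i=[\mathbf{v}_i^1\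 \cdots\ \mathbf{v}_i^d]$. (In floating-point arithmetic a numerical refinement of the subspaces $\mathrm{span}(V_i)$ is performed here; it plays no role in exact arithmetic.) (S6) Solve the linear system $\sum_{i=1}^r x_i\,\mathbf{v}_i^1\wedge\dots\wedge\mathbf{v}_i^d=\mathcal{A}$ for $x_1,\dots,x_r$. (S7) Output the elementary skew-symmetric tensors $x_i\,(U\mathbf{v}_i^1)\wedge\dots\wedge(U\mathbf{v}_i^d)$, $i=1,\dots,r$. *)

(* Defs.v *)
From HB Require Import structures.
From mathcomp Require Import all_boot all_order all_fingroup all_algebra.
From mathcomp.real_closed Require Import complex.
From mathcomp Require Import reals.
From mathcomp.multinomials Require Import mpoly.

Set Implicit Arguments.
Unset Strict Implicit.
Unset Printing Implicit Defensive.

Import Order.TTheory GRing.Theory Num.Theory.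
Local Open Scope ring_scope.

(* ------------------------------------------------------------------------ *)
(* Zariski topology of a finite-dimensional vector space.  Polynomial       *)
(* functions are polynomials in the coordinates with respect to a basis;    *)
(* the notions below do not depend on that basis.                           *)

Definition poly_fun (F : fieldType) (V : vectType F)
    (p : {mpoly F[\dim {:V}]}) (v : V) : F :=
  p.@[fun k => coord (vbasis {:V}) k v].

Definition zariski_closed (F : fieldType) (V : vectType F)
    (Z : V -> Prop) : Prop :=
  exists S : {mpoly F[\dim {:V}]} -> Prop,
    forall v, Z v <-> (forall p, S p -> poly_fun p v = 0).

Definition zariski_closure (F : fieldType) (V : vectType F)
    (A : V -> Prop) (v : V) : Prop :=
  forall Z : V -> Prop, zariski_closed Z -> (forall a, A a -> Z a) -> Z v.

(* The closed subsets of a subvariety X of V are the traces on X of the     *)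
(* closed subsets of V.                                                     *)
Definition generically (F : fieldType) (V : vectType F)
    (X : V -> Prop) (P : V -> Prop) : Prop :=
  exists Z : V -> Prop,
    [/\ zariski_closed Z,
        exists v, X v /\ ~ Z v
      & forall v, X v -> ~ Z v -> P v].

(* ------------------------------------------------------------------------ *)
(* The space (F^m)^{(x) d}, in coordinates: a multi-index is a function     *)
(* i : 'I_d -> 'I_m, and T i is the coefficient of T at                     *)
(* e_(i 0) (x) ... (x) e_(i (d - 1)).                                       *)

Notation multi_index m d := {ffun 'I_d -> 'I_m}.
Notation tensor F m d := {ffun multi_index m d -> F^o}.

Definition tensor_prod (F : fieldType) (m d : nat)
    (v : 'I_d -> 'cV[F]_m) : tensor F m d :=
  [ffun i : multi_index m d => \prod_(k < d) v k (i k) 0].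

Definition wedge (F : fieldType) (m d : nat)
    (v : 'I_d -> 'cV[F]_m) : tensor F m d :=
  (d`!%:R)^-1 *: \sum_(s : 'S_d) (-1) ^+ s *: tensor_prod (fun k => v (s k)).

Definition sum_of_elementary (F : fieldType) (m d r : nat)
    (T : tensor F m d) : Prop :=
  exists v : 'I_r -> 'I_d -> 'cV[F]_m, T = \sum_(i < r) wedge (v i).

Definition grassmann_variety (F : fieldType) (m d r : nat) :
    tensor F m d -> Prop :=
  zariski_closure (@sum_of_elementary F m d r).

Definition map_tensor (F E : fieldType) (f : F -> E) (m d : nat)
    (T : tensor F m d) : tensor E m d :=
  [ffun i : multi_index m d => f (T i)].

(* (A_0, ..., A_(d-1)) . T *)
Definition multilinear_mul (F : fieldType) (p m d : nat)
    (A : 'I_d -> 'M[F]_(p, m)) (T : tensor F m d) : tensor F p d :=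
  [ffun i : multi_index p d =>
    \sum_(j : multi_index m d) (\prod_(k < d) A k (i k) (j k)) * T j].

(* A ._k T *)
Definition mode_mul (F : fieldType) (m d : nat) (k : 'I_d) (A : 'M[F]_m)
    (T : tensor F m d) : tensor F m d :=
  multilinear_mul (fun l => if l == k then A else 1%:M) T.

(* The k-th standard flattening.  Its columns are numbered by the           *)
(* multi-indices j of length d - 1; row a, column j holds the entry of T at *)
(* the multi-index obtained by inserting a into j at position k.            *)
Definition flattening (F : fieldType) (m d : nat) (k : 'I_d)
    (T : tensor F m d) : 'M[F]_(m, #|{: multi_index m d.-1}|) :=
  \matrix_(a, c)
    T [ffun l => oapp (enum_val c : multi_index m d.-1) a (unlift k l)].

Definition delta (F : fieldType) (n d : nat) (A : tensor F n d)
    (X : 'M[F]_n) : tensor F n d :=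
  \sum_(k < d) mode_mul k X A.

Lemma mode_mul_linear (F : fieldType) (n d : nat) (k : 'I_d)
    (A : tensor F n d) : linear (fun X : 'M[F]_n => mode_mul k X A).
Proof.
move=> a X Y; apply/ffunP => i; rewrite !ffunE.
rewrite /GRing.scale /= mulr_sumr -big_split /=; apply: eq_bigr => j _.
rewrite mulrA -mulrDl; congr (_ * _).
have E (Z : 'M[F]_n) :
    \prod_(l < d) (if l == k then Z else 1%:M) (i l) (j l) =
    Z (i k) (j k) * \prod_(l < d | l != k) (1%:M : 'M[F]_n) (i l) (j l).
  rewrite (bigD1 k) //= eqxx; congr (_ * _).
  by apply: eq_bigr => l /negPf ->.
by rewrite !E !mxE mulrDl mulrA.
Qed.

Lemma delta_is_linear (F : fieldType) (n d : nat) (A : tensor F n d) :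
  linear (delta A).
Proof.
move=> a X Y; rewrite /delta scaler_sumr -big_split /=.
by apply: eq_bigr => k _; rewrite mode_mul_linear.
Qed.

HB.instance Definition _ (F : fieldType) (n d : nat) (A : tensor F n d) :=
  GRing.isLinear.Build F 'M[F]_n (tensor F n d) _ (delta A)
    (delta_is_linear A).

(* linfun represents delta A by its matrix, and lker is the kernel of that  *)
(* matrix.                                                                  *)
Definition kappa (F : fieldType) (n d : nat) (A : tensor F n d) :
    {vspace 'M[F]_n} :=
  lker (linfun (delta A)).

Lemma mem_kappa (F : fieldType) (n d : nat) (A : tensor F n d) (X : 'M[F]_n) :
  (X \in kappa A) = (delta A X == 0).
Proof. by rewrite memv_ker lfunE. Qed.

(* ------------------------------------------------------------------------ *)
(* The algorithm.  The field F is R or C = R[i]; it comes with its          *)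
(* conjugation cj and its embedding iota into C, where the eigenvalue       *)
(* decomposition and the steps that follow it take place.  A step that      *)
(* leaves a choice is an input-output relation.  The d * r columns are      *)
(* numbered by mxvec_index i k = i * d + k (i < r, k < d), so that          *)
(* mxvec_index i k is the k-th column of the i-th block.                    *)

Definition adjoint (F : fieldType) (cj : F -> F) (m n : nat)
    (U : 'M[F]_(m, n)) : 'M[F]_(n, m) :=
  map_mx cj U^T.

Definition orthonormal_basis_of_columns (F : fieldType) (cj : F -> F)
    (m n p : nat) (B : 'M[F]_(m, p)) (U : 'M[F]_(m, n)) : Prop :=
  adjoint cj U *m U = 1%:M /\ (U^T == B^T)%MS.

Definition compress (F : fieldType) (cj : F -> F) (m n d : nat)
    (U : 'M[F]_(m, n)) (T : tensor F m d) : tensor F n d :=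
  multilinear_mul (fun=> adjoint cj U) T.

Definition eigendecomposition (C : fieldType) (n : nat) (K : 'M[C]_n)
    (WL : 'M[C]_n * 'rV[C]_n) : Prop :=
  WL.1 \in unitmx /\ K = WL.1 *m diag_mx WL.2 *m invmx WL.1.

Definition block_diagonal (C : fieldType) (r d : nat)
    (M : 'M[C]_(r * d)) : Prop :=
  forall (i j : 'I_r) (k l : 'I_d),
    i != j -> M (mxvec_index i k) (mxvec_index j l) = 0.

Definition block_diagonalizing (C : fieldType) (r d : nat)
    (K' W P : 'M[C]_(r * d)) : Prop :=
  is_perm_mx P /\ block_diagonal (P^T *m invmx W *m K' *m W *m P).

Definition block_col (C : fieldType) (r d : nat) (M : 'M[C]_(r * d))
    (i : 'I_r) (k : 'I_d) : 'cV[C]_(r * d) :=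
  col (mxvec_index i k) M.

Definition solves_for (C : fieldType) (n r d : nat)
    (v : 'I_r -> 'I_d -> 'cV[C]_n) (A : tensor C n d) (x : 'I_r -> C) : Prop :=
  \sum_(i < r) x i *: wedge (v i) = A.

(* The step can be carried out, and Q holds for all its possible outputs.   *)
Definition step (O : Type) (output : O -> Prop) (Q : O -> Prop) : Prop :=
  (exists o, output o) /\ (forall o, output o -> Q o).

Definition algorithm_decomposes (R : realType) (F : fieldType)
    (cj : F -> F) (iota : F -> R[i]) (m d r : nat) (d_gt0 : (0 < d)%N)
    (T : tensor F m d) : Prop :=
  let T1 := flattening (Ordinal d_gt0) T in
  step (orthonormal_basis_of_columns cj T1) (fun U : 'M[F]_(m, r * d) =>
  let A := compress cj U T in
  generically (fun K => K \in kappa A) (fun K : 'M[F]_(r * d) =>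
  step (eigendecomposition (map_mx iota K)) (fun WL =>
  let W := WL.1 in
  generically (fun K' => K' \in kappa A) (fun K' : 'M[F]_(r * d) =>
  step (block_diagonalizing (map_mx iota K') W) (fun P : 'M[R[i]]_(r * d) =>
  let v := block_col (W *m P) in
  step (solves_for v (map_tensor iota A)) (fun x =>
  map_tensor iota T =
    \sum_(i < r) x i *: wedge (fun k => map_mx iota U *m v i k))))))).

(* Main.v *)
Require Import Defs.
From HB Require Import structures.
From mathcomp Require Import all_boot all_order all_fingroup all_algebra.
From mathcomp Require Import all_field.
From mathcomp.real_closed Require Import complex.
From mathcomp Require Import reals.
From mathcomp.multinomials Require Import mpoly.

Set Implicit Arguments.
Unset Strict Implicit.
Unset Printing Implicit Defensive.

Import Order.TTheory GRing.Theory Num.Theory.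
Local Open Scope ring_scope.

(** Suppose that T is the sum of the r elementary tensors
    v_i^1 /\ ... /\ v_i^d with d * r linearly independent vectors v_i^k, the
    general situation.  The column space of the first flattening of T is the
    span of these vectors, so compressing by U loses nothing: A is the sum of
    the r elementary tensors on the columns of an invertible matrix G of size
    d * r, and T is the image of A under U ([flattening_sum_wedge],
    [algorithm_decomposes_sum]).  Hence every solution of the final linear
    system yields a decomposition of T, and what has to be shown is that no
    step of the algorithm gets stuck.

    The structure of the kernel is what makes this work.  In the basis given by
    the columns of G, the kernel of delta_A consists of the block diagonal
    matrices with traceless blocks; d >= 3 is what excludes nonzero entries
    outside the blocks ([kappa_block_diagonal], [traceless_blocks_kappa]).  A
    generic K in the kernel therefore has simple spectrum, and each of its
    eigenvectors lies in the span of one block of columns of G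
    ([simple_spectrum_regrading]).  In a basis of such eigenvectors a generic
    K' in the kernel has nonzero entries wherever the row and the column belong
    to the same span.  A permutation that makes K' block diagonal exists, and
    any such permutation must put the d eigenvectors of each span together
    ([block_diagonalizing_regroups]).  The wedge of these d eigenvectors is a
    nonzero multiple of the corresponding summand of A, so the linear system is
    solvable ([solvable_regrouped]).

    There remains the passage from sums to generic elements of the Zariski
    closure X of the set of sums, since X contains tensors that are not sums.
    Over the complex numbers, quantifier elimination shows that the image of a
    polynomial map contains a nonempty open subset of its closure
    ([image_contains_open_of_closure]); on X, being a sum is thus an open
    generic property, and so is linear independence of the vectors, which is
    maximality of the rank of the flattening ([full_rank_poly]).  Over the
    reals the generic element of X need not be a real sum: the real part of a
    general complex elementary tensor is an example with r = 2 when d = 3.  But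
    it is a sum over the complex numbers, and this is all that is needed,
    because the algorithm works over the complex numbers from the eigenvalue
    decomposition on.  Both fields F are treated at once, through an embedding iota of F into
    C = R[i] and F-linear components re and im on C: they turn the zero set of
    a complex polynomial into a Zariski closed set over F ([zero_set_closed]),
    and elements of the complexified kernel into elements of the kernel over F.
    The open sets found over C contain points over F because a nonzero
    polynomial does not vanish at all points with natural coordinates
    ([mpoly_nat_nonroot]). *)

(** * Nonvanishing of polynomials at points with natural coordinates *)

Lemma poly_nat_nonroot (C : numDomainType) (u : {poly C}) :
  u != 0 -> exists k : nat, u.[k%:R] != 0.
Proof.
move=> u0; pose s : seq C := [seq k%:R | k <- iota 0 (size u)].
have /allPn[x /mapP[k _ ->] nr] : ~~ all (root u) s.
  apply/negP => ar; have := max_poly_roots u0 ar.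
  rewrite map_inj_uniq ?iota_uniq ?size_map ?size_iota ?ltnn; last first.
    by move=> a b /eqP; rewrite eqr_nat => /eqP.
  by move=> /(_ isT).
by exists k.
Qed.

(** Points with natural coordinates exist over every subfield of [C], so this
    provides points over the reals where a complex polynomial is nonzero. *)
Lemma mpoly_nat_nonroot (C : numDomainType) n (p : {mpoly C[n]}) :
  p != 0 -> exists a : 'I_n -> nat, p.@[fun i => (a i)%:R] != 0.
Proof.
elim: n p => [|n IH] p p0.
  exists (fun=> 0%N); rewrite mevalE.
  have m0 (m : 'X_{1..0}) : m = mlead p by apply/mnmP => -[].
  rewrite (eq_bigr (fun=> p@_(mlead p))); last first.
    by move=> m _; rewrite big_ord0 mulr1 -(m0 m).
  rewrite big_const_seq count_predT iter_addr_0 mulrn_eq0 mleadc_eq0 negb_or p0.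
  by rewrite size_eq0 msupp_eq0 p0.
pose w (i : 'I_n) : 'I_n.+1 := widen_ord (leqnSn n) i.
pose res (m : 'X_{1..n.+1}) := [multinom m (w i) | i < n].
(* The leading monomial of [p] occurs in this coefficient of [p], seen as a
   polynomial in the last variable, which is thus nonzero. *)
have [] := IH (muni p)`_(mlead p ord_max).
  apply: contraNneq (p0) => /(congr1 (mcoeff (res (mlead p)))).
  rewrite mcoeff0 muniE coef_sum raddf_sum /=.
  rewrite (bigD1_seq (mlead p)) ?mlead_supp //=.
  rewrite -mul_mpolyC coefZ coefXn eqxx mulr1 mul_mpolyC mcoeffZ mcoeffX eqxx.
  rewrite mulr1 big1 ?addr0 => [/eqP|m mn]; first by rewrite mleadc_eq0.
  rewrite coefZ coefXn; case: eqP => [em|_]; last by rewrite mulr0 mcoeff0.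
  rewrite mulr1 mcoeffZ mcoeffX; case: eqP => [er|]; last by rewrite mulr0.
  case/eqP: mn; apply/mnmP => i; case: (unliftP ord_max i) => [j ->|-> //].
  have := congr1 (fun m : 'X_{1..n} => m j) er; rewrite !mnmE.
  have -> // : lift ord_max j = w j.
  by apply: val_inj; rewrite /= /bump leqNgt ltn_ord.
move=> a qa.
have [|t ut] :=
    @poly_nat_nonroot C (map_poly (meval (fun i => (a i)%:R)) (muni p)).
  apply: contraNneq qa => e.
  by rewrite -coef_map e coef0.
pose b (i : 'I_n.+1) := if unlift ord_max i is Some j then a j else t.
exists b; apply: contraNneq ut => e; rewrite -[X in _ == X]e.
rewrite muniE mevalE rmorph_sum /= horner_sum; apply/eqP/eq_bigr => m _.
rewrite map_polyZ /= map_polyXn hornerZ hornerXn mevalZ mevalX big_ord_recr /=.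
rewrite mulrA; congr (_ * _ * _).
  apply: eq_bigr => i _.
  rewrite mnmE /b (_ : widen_ord _ i = lift ord_max i) ?liftK //.
  by apply: val_inj; rewrite /= /bump leqNgt ltn_ord.
by rewrite /b unlift_none.
Qed.

(** * The image of a polynomial map contains an open subset of its closure *)

Section Terms.
Variables (C : fieldType) (N : nat).

(** Variables beyond the first [N] are sent to 0, in accordance with the default
    value of environments; inverses do not occur in the ring terms to which
    this is applied. *)
Fixpoint mpoly_of_term (t : GRing.term C) : {mpoly C[N]} :=
  match t with
  | GRing.Var i => if insub i is Some j then 'X_j else 0
  | GRing.Const c => c%:MP
  | GRing.NatConst k => k%:R
  | GRing.Add t1 t2 => mpoly_of_term t1 + mpoly_of_term t2
  | GRing.Opp t1 => - mpoly_of_term t1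
  | GRing.NatMul t1 k => mpoly_of_term t1 *+ k
  | GRing.Mul t1 t2 => mpoly_of_term t1 * mpoly_of_term t2
  | GRing.Inv _ => 0
  | GRing.Exp t1 k => mpoly_of_term t1 ^+ k
  end.

Definition env (y : 'I_N -> C) : seq C := [seq y i | i <- enum 'I_N].

Lemma nth_env y (i : 'I_N) : (env y)`_i = y i.
Proof. by rewrite (nth_map i) ?size_enum_ord // nth_ord_enum. Qed.

Lemma env_default y i : (N <= i)%N -> (env y)`_i = 0.
Proof. by move=> Ni; rewrite nth_default // size_map size_enum_ord. Qed.

Lemma eval_mpoly_of_term y t :
  GRing.rterm t -> GRing.eval (env y) t = (mpoly_of_term t).@[y].
Proof.
elim: t => //=.
- move=> i _; case: insubP => [j _ <-|]; first by rewrite mevalXU nth_env.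
  by rewrite -leqNgt => Ni; rewrite meval0 env_default.
- by move=> c _; rewrite mevalC.
- by move=> k _; rewrite rmorph_nat.
- by move=> t1 IH1 t2 IH2 /andP[r1 r2]; rewrite mevalD IH1 ?IH2.
- by move=> t1 IH1 r1; rewrite mevalN IH1.
- by move=> t1 IH1 k r1; rewrite mevalMn IH1.
- by move=> t1 IH1 t2 IH2 /andP[r1 r2]; rewrite mevalM IH1 ?IH2.
- by move=> t1 IH1 k r1; rewrite rmorphXn /= IH1.
Qed.

Definition term_of_mpoly (M k : nat) (p : {mpoly C[M]}) : GRing.term C :=
  foldr GRing.Add (GRing.Const 0)
   [seq GRing.Mul (GRing.Const p@_m)
     (foldr GRing.Mul (GRing.Const 1)
        [seq GRing.Exp (GRing.Var C (k + i)) (m i) | i : 'I_M <- enum 'I_M])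
   | m : 'X_{1..M} <- msupp p].

Lemma rterm_of_mpoly M k (p : {mpoly C[M]}) : GRing.rterm (term_of_mpoly k p).
Proof.
rewrite /term_of_mpoly; elim: (msupp p : seq _) => //= m s ->; rewrite andbT.
by elim: (enum _).
Qed.

Lemma eval_term_of_mpoly M k (p : {mpoly C[M]}) e :
  GRing.eval e (term_of_mpoly k p) = p.@[fun i => e`_(k + i)].
Proof.
rewrite mevalE /term_of_mpoly.
elim: (msupp p : seq _) => [|m s IH] /=; first by rewrite big_nil.
rewrite big_cons -IH; congr (_ * _ + _).
rewrite -big_enum /=; elim: (enum _) => [|i r IHr] /=; first by rewrite big_nil.
by rewrite big_cons -IHr.
Qed.

End Terms.

(** The ideal of polynomials vanishing on a parametrized set is prime: the
    closure of the set is irreducible. *)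
Lemma comp_mpolyM_neq0 (R : idomainType) (M N : nat) (p q : {mpoly R[N]})
    (t : N.-tuple {mpoly R[M]}) :
  p \mPo t != 0 -> q \mPo t != 0 -> (p * q) \mPo t != 0.
Proof. by rewrite rmorphM; apply: mulf_neq0. Qed.

Section Chevalley.
Variables (C : closedFieldType) (M N : nat) (phi : 'I_N -> {mpoly C[M]}).

Notation pull q := (q \mPo [tuple phi j | j < N]).

Definition in_image_closure (y : 'I_N -> C) :=
  forall p : {mpoly C[N]}, pull p = 0 -> p.@[y] = 0.

(** On an irreducible set every polynomial either vanishes identically or is
    nonzero on a dense open subset, so every atomic formula is generically true
    or generically false; dense open subsets being stable under finite
    intersection, so is every Boolean combination. *)
Lemma qf_generically_constant (f : GRing.formula C) :
  GRing.qf_form f -> GRing.rformula f ->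
  exists b : bool, exists2 q : {mpoly C[N]}, pull q != 0 &
    forall y, in_image_closure y -> q.@[y] != 0 -> GRing.qf_eval (env y) f = b.
Proof.
have pullM (q1 q2 : {mpoly C[N]}) : pull q1 != 0 -> pull q2 != 0 ->
    pull (q1 * q2) != 0 /\
    forall y, (q1 * q2).@[y] != 0 -> q1.@[y] != 0 /\ q2.@[y] != 0.
  move=> n1 n2; split=> [|y]; first exact: comp_mpolyM_neq0.
  by rewrite mevalM mulf_eq0 negb_or => /andP.
elim: f => //=.
- by move=> b _ _; exists b, 1 => //; rewrite rmorph1 oner_eq0.
- move=> t1 t2 _ /andP[r1 r2].
  have [e|ne] := eqVneq (pull (mpoly_of_term N t1 - mpoly_of_term N t2)) 0.
    exists true, 1; first by rewrite rmorph1 oner_eq0.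
    move=> y /(_ _ e) + _; rewrite mevalB -!eval_mpoly_of_term // => /eqP.
    by rewrite subr_eq0.
  exists false; exists (mpoly_of_term N t1 - mpoly_of_term N t2) => // y _.
  by rewrite mevalB -!eval_mpoly_of_term // subr_eq0 => /negPf.
- move=> f1 IH1 f2 IH2 /andP[q1 q2] /andP[r1 r2].
  have [b1 [p1 n1 h1]] := IH1 q1 r1; have [b2 [p2 n2 h2]] := IH2 q2 r2.
  have [n h] := pullM _ _ n1 n2.
  exists (b1 && b2), (p1 * p2) => // y Xy /h[y1 y2].
  by rewrite h1 // h2.
- move=> f1 IH1 f2 IH2 /andP[q1 q2] /andP[r1 r2].
  have [b1 [p1 n1 h1]] := IH1 q1 r1; have [b2 [p2 n2 h2]] := IH2 q2 r2.
  have [n h] := pullM _ _ n1 n2.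
  exists (b1 || b2), (p1 * p2) => // y Xy /h[y1 y2].
  by rewrite h1 // h2.
- move=> f1 IH1 f2 IH2 /andP[q1 q2] /andP[r1 r2].
  have [b1 [p1 n1 h1]] := IH1 q1 r1; have [b2 [p2 n2 h2]] := IH2 q2 r2.
  have [n h] := pullM _ _ n1 n2.
  exists (b1 ==> b2), (p1 * p2) => // y Xy /h[y1 y2].
  by rewrite h1 // h2.
- move=> f1 IH1 q1 r1; have [b1 [p1 n1 h1]] := IH1 q1 r1.
  by exists (~~ b1), p1 => // y Xy py; rewrite h1.
Qed.

(** The variables of index below [N] are the coordinates of the point of the
    target, the [M] next ones, which are quantified, those of the source. *)
Definition image_formula : GRing.formula C :=
  foldr GRing.Exists
    (foldr GRing.And (GRing.Bool true)
       [seq GRing.Equal (GRing.Var C j) (term_of_mpoly N (phi j))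
       | j : 'I_N <- enum 'I_N])
    (iota N M).

Lemma rformula_image_formula : GRing.rformula image_formula.
Proof.
rewrite /image_formula; elim: (iota N M) => //=.
by elim: (enum 'I_N) => //= j s ->; rewrite rterm_of_mpoly.
Qed.

Lemma holds_image_formula y :
  GRing.holds (env y) image_formula <->
  exists a : 'I_M -> C, forall j, y j = (phi j).@[a].
Proof.
rewrite -GRing.foldExistsP; split.
- case=> e ee; set s := map _ _ => h; exists (fun i => e`_(N + i)) => j.
  have : (j \in enum 'I_N) by rewrite mem_enum.
  rewrite -(nth_env y) ee ?inE; last by rewrite mem_iota leqNgt ltn_ord.
  move: h; rewrite {}/s; elim: (enum 'I_N) => //= i s IH [h1 h2].
  rewrite inE => /orP[/eqP ->|]; first by rewrite -eval_term_of_mpoly.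
  exact: IH.
- case=> a ya; pose e := env y ++ env a.
  have szy : size (env y) = N by rewrite size_map size_enum_ord.
  exists e => [i|].
    rewrite inE mem_iota negb_and -ltnNge -leqNgt /e nth_cat szy.
    case: ltnP => //= Ni Mi; rewrite [LHS]env_default // env_default //.
    by rewrite leq_subRL.
  elim: (enum 'I_N) => //= j s IH; split=> //.
  rewrite eval_term_of_mpoly /e nth_cat szy ltn_ord nth_env ya.
  apply: meval_eq => i.
  by rewrite nth_cat szy ltnNge leq_addr /= addKn nth_env.
Qed.

End Chevalley.

(** Eliminating quantifiers from [image_formula] leaves a formula that is
    generically constant on the closure; the constant is true because a dense
    open subset of the closure contains points of the image. *)
Theorem image_contains_open_of_closure (C : numClosedFieldType) (M N : nat)
    (phi : 'I_N -> {mpoly C[M]}) :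
  exists2 q : {mpoly C[N]}, q \mPo [tuple phi j | j < N] != 0 &
    forall y, in_image_closure phi y -> q.@[y] != 0 ->
      exists a : 'I_M -> C, forall j, y j = (phi j).@[a].
Proof.
have wf := @ClosedFieldQE.wf_ex_elim C.
have ok := ClosedFieldQE.holds_ex_elim (@solve_monicpoly C).
have rf := rformula_image_formula phi.
have qeP e := GRing.quantifier_elim_rformP wf ok e rf.
have /andP[qf qr] := GRing.quantifier_elim_wf wf rf.
have [b [q q0 hq]] := qf_generically_constant phi qf qr.
suff bT : b by exists q => // y Xy qy; apply/holds_image_formula/qeP; rewrite hq.
have [a qa] := mpoly_nat_nonroot q0.
pose y j := (phi j).@[fun i => (a i)%:R].
have ev (p : {mpoly C[N]}) :
    (p \mPo [tuple phi j | j < N]).@[fun i => (a i)%:R] = p.@[y].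
  by rewrite comp_mpoly_meval; apply: meval_eq => j; rewrite tnth_mktuple.
rewrite -(hq y); last by rewrite -ev.
  by apply/qeP/holds_image_formula; exists (fun i => (a i)%:R).
by move=> p p0; rewrite -ev p0 meval0.
Qed.

(** * Wedge products, and the kernel of delta at a sum of independent blocks *)

Section Multilinear.
Variable F : fieldType.

Lemma multilinear_mul_is_linear (p m d : nat) (A : 'I_d -> 'M[F]_(p, m)) :
  linear (@multilinear_mul F p m d A).
Proof.
move=> a T T'; apply/ffunP => i; rewrite !ffunE scaler_sumr -big_split /=.
apply: eq_bigr => j _; rewrite !ffunE mulrDr; congr (_ + _).
by rewrite mulrCA.
Qed.

HB.instance Definition _ (p m d : nat) (A : 'I_d -> 'M[F]_(p, m)) :=
  GRing.isLinear.Build F (tensor F m d) (tensor F p d) _ (multilinear_mul A)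
    (multilinear_mul_is_linear A).

Lemma eq_tensor_prod (m d : nat) (v w : 'I_d -> 'cV[F]_m) :
  v =1 w -> tensor_prod v = tensor_prod w.
Proof.
by move=> e; apply/ffunP => i; rewrite !ffunE; apply: eq_bigr => k _; rewrite e.
Qed.

Lemma eq_wedge (m d : nat) (v w : 'I_d -> 'cV[F]_m) :
  v =1 w -> wedge v = wedge w.
Proof.
move=> e; congr (_ *: _); apply: eq_bigr => s _; congr (_ *: _).
by apply: eq_tensor_prod => k; apply: e.
Qed.

Lemma multilinear_mul_tensor_prod (p m d : nat) (A : 'I_d -> 'M[F]_(p, m))
    (v : 'I_d -> 'cV[F]_m) :
  multilinear_mul A (tensor_prod v) = tensor_prod (fun k => A k *m v k).
Proof.
apply/ffunP => i; rewrite !ffunE.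
under [RHS]eq_bigr => k _ do rewrite mxE.
rewrite bigA_distr_bigA /=; apply: eq_bigr => j _.
by rewrite !ffunE -big_split.
Qed.

Lemma multilinear_mul_wedge (p m d : nat) (A : 'M[F]_(p, m))
    (v : 'I_d -> 'cV[F]_m) :
  multilinear_mul (fun=> A) (wedge v) = wedge (fun k => A *m v k).
Proof.
rewrite linearZ linear_sum /=; congr (_ *: _); apply: eq_bigr => s _.
by rewrite linearZ /= multilinear_mul_tensor_prod.
Qed.

Lemma wedgeE (m d : nat) (v : 'I_d -> 'cV[F]_m) (i : multi_index m d) :
  wedge v i = (d`!%:R)^-1 * \det (\matrix_(k, l) v l (i k) 0).
Proof.
rewrite ffunE; congr (_ * _); rewrite sum_ffunE; apply: eq_bigr => s _.
rewrite !ffunE; congr (_ * _); apply: eq_bigr => k _.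
by rewrite mxE.
Qed.

Lemma wedge_change_of_basis (m d : nat) (v : 'I_d -> 'cV[F]_m) (M : 'M[F]_d) :
  wedge (fun k => \sum_l M l k *: v l) = \det M *: wedge v.
Proof.
apply/ffunP => i; rewrite [RHS]ffunE !wedgeE.
rewrite [RHS]mulrCA; congr (_ * _).
rewrite mulrC -det_mulmx; congr (\det _); apply/matrixP => a b.
rewrite !mxE summxE; apply: eq_bigr => l _.
by rewrite !mxE mulrC.
Qed.

(** A permutation other than the identity moves at least two indices, one of
    which is not sent to [k], and then contributes an off-diagonal entry of the
    identity matrix: only the identity permutation counts. *)
Lemma det_replace_col (n : nat) (k : 'I_n) (f : 'I_n -> F) :
  \det (\matrix_(i, j) if j == k then f i else (i == j)%:R) = f k.
Proof.
rewrite /determinant (bigD1 1%g) //= [X in _ + X]big1 => [|s s1].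
  rewrite addr0 odd_perm1 expr0 mul1r (bigD1 k) //= big1 => [|i ik].
    by rewrite mulr1 mxE perm1 eqxx.
  by rewrite mxE perm1 (negPf ik) eqxx.
have [i si] : exists i, s i != i.
  apply/existsP; apply: contraNT s1 => /existsPn h.
  by apply/eqP/permP => i; rewrite perm1; apply/eqP/negbNE/h.
have [i' si' sk] : exists2 i', s i' != i' & s i' != k.
  have [e|] := eqVneq (s i) k; last by exists i.
  exists k; rewrite -e; first by rewrite (inj_eq perm_inj).
  by rewrite (inj_eq perm_inj).
by rewrite (bigD1 i') //= mxE (negPf sk) eq_sym (negPf si') mul0r mulr0.
Qed.

Definition replace (m d : nat) (v : 'I_d -> 'cV[F]_m) (k : 'I_d) (u : 'cV[F]_m)
  (l : 'I_d) := if l == k then u else v l.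

(** [delta] acts on wedges as a derivation. *)
Lemma delta_wedge (n d : nat) (v : 'I_d -> 'cV[F]_n) (X : 'M[F]_n) :
  delta (wedge v) X = \sum_(k < d) wedge (replace v k (X *m v k)).
Proof.
pose t (s : 'S_d) (k : 'I_d) :=
  tensor_prod (fun l => replace v k (X *m v k) (s l)).
rewrite /delta.
transitivity (\sum_(k < d) (d`!%:R)^-1 *: \sum_(s : 'S_d) (-1) ^+ s *: t s (s k)).
  apply: eq_bigr => k _; rewrite /mode_mul linearZ linear_sum /=.
  congr (_ *: _); apply: eq_bigr => s _; rewrite linearZ /=; congr (_ *: _).
  rewrite multilinear_mul_tensor_prod; apply: eq_tensor_prod => l.
  rewrite /replace (inj_eq perm_inj); case: eqP => [->//|_].
  by rewrite mul1mx.
rewrite -!scaler_sumr exchange_big /=; congr (_ *: _).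
rewrite [RHS]exchange_big /=; apply: eq_bigr => s _; rewrite -!scaler_sumr.
by congr (_ *: _); rewrite [RHS](reindex_inj (@perm_inj _ s)).
Qed.

Lemma delta_sum (n d : nat) (I : finType) (A : I -> tensor F n d) (X : 'M[F]_n) :
  delta (\sum_i A i) X = \sum_i delta (A i) X.
Proof.
rewrite /delta exchange_big /=; apply: eq_bigr => k _.
by rewrite /mode_mul linear_sum.
Qed.

End Multilinear.

Lemma mxvec_index_surj (m n : nat) (a : 'I_(m * n)) :
  exists i j, a = mxvec_index i j.
Proof. by case/mxvec_indexP: a => i j; exists i, j. Qed.

Lemma mxvec_index_inj (m n : nat) (i i' : 'I_m) (j j' : 'I_n) :
  (mxvec_index i j == mxvec_index i' j') = (i == i') && (j == j').
Proof.
rewrite /mxvec_index (inj_eq (@cast_ord_inj _ _ _)) (inj_eq enum_rank_inj).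
by rewrite xpair_eqE.
Qed.

Lemma big_mxvec_index (V : nmodType) (m n : nat) (f : 'I_(m * n) -> V) :
  \sum_a f a = \sum_i \sum_j f (mxvec_index i j).
Proof.
rewrite pair_bigA (reindex _ (curry_mxvec_bij _ _)) /=.
by apply: eq_bigr => -[i j] _.
Qed.

Section Kappa.
Variables (F : fieldType) (r d : nat) (G : 'M[F]_(r * d)).
Hypotheses (d_gt2 : (2 < d)%N) (dF : d`!%:R != 0 :> F) (Gu : G \in unitmx).

Let A : tensor F (r * d) d := \sum_(i < r) wedge (block_col G i).

(** For [i != j] the entry of [invmx G *m X *m G] in row (i, k) and column
    (j, l) is, up to the factor [d`!], the coordinate of [delta A X], in the
    basis [G], on the tensor product of the vectors of block j with the l-th one
    replaced by the vector (i, k).  For a summand of [delta A X] to contribute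
    to it, all vectors but one must come from the same block; as there are at
    least three factors, two at least belong to block j, which rules out every
    other block. *)
Lemma kappa_block_diagonal (X : 'M[F]_(r * d)) :
  X \in kappa A -> block_diagonal (invmx G *m X *m G).
Proof.
rewrite mem_kappa => /eqP X0 i j k l ij.
set Y := invmx G *m X *m G.
pose e (i : 'I_r) (k : 'I_d) : 'cV[F]_(r * d) := col (mxvec_index i k) 1%:M.
have := congr1 (multilinear_mul (fun=> invmx G)) X0.
rewrite /A delta_sum linear0 linear_sum /=.
under eq_bigr => i' _.
  rewrite delta_wedge linear_sum /=; under eq_bigr => k' _.
    rewrite multilinear_mul_wedge.
    have /eq_wedge -> : (fun l' => invmx G *m
        replace (block_col G i') k' (X *m block_col G i' k') l') =1
        replace (e i') k' (Y *m e i' k').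
      move=> l'; rewrite /replace; case: eqP => _; last first.
        by rewrite /block_col /e !colE mulmxA mulVmx // mul1mx.
      by rewrite /block_col /e !colE /Y !mulmxA mulmx1.
    over.
  over.
(* The multi-index at which the tensor [delta A X] is read off. *)
pose I : multi_index (r * d) d :=
  [ffun l' => if l' == l then mxvec_index i k else mxvec_index j l'].
move/(congr1 (fun T : tensor F (r * d) d => T I)).
rewrite [in RHS]ffunE sum_ffunE (bigD1 j) //= [X in _ + X]big1; last first.
  move=> i' i'j; rewrite sum_ffunE big1 // => k' _; rewrite wedgeE.
  rewrite [\det _]big1 ?mulr0 // => s _.
  (* For [i' != j] the rows other than [l] vanish off column [k'], and as there
     are at least two of them, [s] does not send all of them to [k']. *)
  have [l1 l1l sl1] : exists2 l1, l1 != l & s l1 != k'.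
    have [l2 l2l] : exists2 l2, l2 != l & l2 != s^-1%g k'.
      have : (0 < #|~: [set l; s^-1%g k']|)%N.
        rewrite cardsCs setCK card_ord subn_gt0 (leq_ltn_trans _ d_gt2) //.
        by rewrite cards2; case: eqP.
      case/card_gt0P => l2; rewrite !inE negb_or => /andP[h1 h2].
      by exists l2.
    move=> h; exists l2 => //; apply: contraNneq h => <-.
    by rewrite permK.
  rewrite (bigD1 l1) //= mxE /replace (negPf sl1) ffunE (negPf l1l) !mxE.
  by rewrite mxvec_index_inj eq_sym (negPf i'j) mul0r mulr0.
rewrite addr0 sum_ffunE (bigD1 l) //= [X in _ + X]big1; last first.
  move=> k' k'l; rewrite wedgeE (expand_det_col _ l) big1 ?mulr0 // => l1 _.
  rewrite mxE /replace eq_sym (negPf k'l) ffunE !mxE.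
  case: (eqVneq l1 l) => [_|l1l]; rewrite mxvec_index_inj.
    by rewrite (negPf ij) mul0r.
  by rewrite (negPf l1l) andbF mul0r.
rewrite addr0 wedgeE => /eqP; rewrite mulf_eq0 invr_eq0 (negPf dF) /=.
rewrite (_ : \matrix_(_, _) _ = \matrix_(l1, l2)
    (if l2 == l then Y (I l1) (mxvec_index j l) else (l1 == l2)%:R)).
  by rewrite (det_replace_col l (fun l1 => Y (I l1) _)) ffunE eqxx => /eqP.
apply/matrixP => l1 l2; rewrite [LHS]mxE [RHS]mxE /replace.
case: (eqVneq l2 l) => [_|l2l].
  by rewrite /e colE mul1mx -colE mxE.
rewrite /I ffunE !mxE; case: (eqVneq l1 l) => [->|l1l]; rewrite mxvec_index_inj.
  by rewrite (negPf ij) [l == _]eq_sym (negPf l2l).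
by rewrite eqxx.
Qed.

(** On a block diagonal matrix, replacing in turn each vector of a block by its
    image multiplies the wedge of the block by a diagonal entry, so the
    derivation multiplies it by the trace of the block. *)
Lemma traceless_blocks_kappa (X : 'M[F]_(r * d)) :
  let Y := invmx G *m X *m G in
  block_diagonal Y ->
  (forall i : 'I_r, \sum_(k < d) Y (mxvec_index i k) (mxvec_index i k) = 0) ->
  X \in kappa A.
Proof.
move=> Y Yd Ytr; rewrite mem_kappa /A delta_sum; apply/eqP/big1 => i _.
rewrite delta_wedge.
have XG k : X *m block_col G i k =
    \sum_l Y (mxvec_index i l) (mxvec_index i k) *: block_col G i l.
  have -> : X *m block_col G i k = G *m col (mxvec_index i k) Y.
    by rewrite /block_col !colE /Y !mulmxA mulmxV // mul1mx.
  apply/matrixP => a b; rewrite mxE summxE big_mxvec_index.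
  rewrite (bigD1 i) //= [X in _ + X]big1 ?addr0 => [|j ji].
    by apply: eq_bigr => l _; rewrite !mxE mulrC.
  by rewrite big1 // => l _; rewrite mxE Yd // mulr0.
transitivity (\sum_(k < d) Y (mxvec_index i k) (mxvec_index i k) *:
     wedge (block_col G i)); last by rewrite -scaler_suml Ytr scale0r.
apply: eq_bigr => k _.
pose M : 'M[F]_d := \matrix_(l1, l2)
    (if l2 == k then Y (mxvec_index i l1) (mxvec_index i k) else (l1 == l2)%:R).
rewrite -(det_replace_col k (fun l1 => Y (mxvec_index i l1) (mxvec_index i k))).
rewrite -/M -wedge_change_of_basis; apply: eq_wedge => l.
rewrite /replace; case: (eqVneq l k) => [->|lk].
  by rewrite XG; apply: eq_bigr => l1 _; rewrite [M _ _]mxE eqxx.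
rewrite (bigD1 l) //= big1 ?addr0 => [|l' l'l].
  by rewrite [M _ _]mxE (negPf lk) eqxx scale1r.
by rewrite [M _ _]mxE (negPf lk) (negPf l'l) scale0r.
Qed.

End Kappa.

(** * Simple spectrum as a polynomial condition *)

Section TraceForm.

(** For a diagonal matrix this is the square of the Vandermonde determinant of
    the diagonal: the discriminant of the characteristic polynomial, written
    as a polynomial in the entries of the matrix. *)
Definition trace_form_det (R : comNzRingType) (n : nat) (K : 'M[R]_n) : R :=
  \det (\matrix_(i < n, j < n) \tr (K ^+ (i + j))).

Lemma map_trace_form_det (R S : comNzRingType) (f : {rmorphism R -> S}) n
    (K : 'M[R]_n) :
  f (trace_form_det K) = trace_form_det (map_mx f K).
Proof.
rewrite /trace_form_det -det_map_mx; congr (\det _); apply/matrixP => i j.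
rewrite !mxE -trace_map_mx; congr (\tr _).
elim: (i + j)%N => [|k IH]; first by rewrite !expr0 map_mx1.
by rewrite !exprS -IH; apply: map_mxM.
Qed.

Lemma expmx_conj (F : fieldType) n (W M : 'M[F]_n) k :
  W \in unitmx -> (W *m M *m invmx W) ^+ k = W *m (M ^+ k) *m invmx W.
Proof.
move=> Wu; elim: k => [|k IH].
  by rewrite !expr0 [W *m 1]mulmx1 mulmxV.
rewrite !exprS IH [LHS]/GRing.mul /= [M * _]/GRing.mul /= !mulmxA.
by rewrite -[W *m M *m invmx W *m W]mulmxA mulVmx // mulmx1.
Qed.

Lemma trace_form_det_conj (F : fieldType) n (W M : 'M[F]_n) :
  W \in unitmx -> trace_form_det (W *m M *m invmx W) = trace_form_det M.
Proof.
move=> Wu; congr (\det _); apply/matrixP => i j; rewrite !mxE expmx_conj //.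
by rewrite mxtrace_mulC mulmxA mulVmx // mul1mx.
Qed.

Lemma trace_form_det_diag (F : fieldType) n (y : 'rV[F]_n) :
  trace_form_det (diag_mx y) = \det (Vandermonde n y) ^+ 2.
Proof.
rewrite expr2 -{2}det_tr -det_mulmx; congr (\det _); apply/matrixP => i j.
rewrite !mxE.
have -> k : diag_mx y ^+ k = diag_mx (\row_a y 0 a ^+ k).
  elim: k => [|k IH].
    rewrite expr0; apply/matrixP => a b; rewrite !mxE expr0.
    by case: eqP.
  rewrite exprS IH [LHS]mulmx_diag; congr diag_mx; apply/rowP => a.
  by rewrite !mxE exprS.
rewrite mxtrace_diag; apply: eq_bigr => a _.
by rewrite !mxE exprD.
Qed.

Lemma trace_form_det_diag_neq0 (F : fieldType) n (y : 'rV[F]_n) :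
  reflect (injective (y 0)) (trace_form_det (diag_mx y) != 0).
Proof.
rewrite trace_form_det_diag expf_eq0 /= det_Vandermonde.
apply: (iffP idP) => [/prodf_neq0 h i j yij|yi].
  apply/val_inj; case: (ltngtP i j) => // ij.
    by have /prodf_neq0/(_ j ij) := h i isT; rewrite yij subrr eqxx.
  by have /prodf_neq0/(_ i ij) := h j isT; rewrite yij subrr eqxx.
apply/prodf_neq0 => i _; apply/prodf_neq0 => j ij; rewrite subr_eq0.
by apply: contraTneq ij => /yi ->; rewrite ltnn.
Qed.

(** With a full rank factorization [M = B *m C], [M *m M = 0] forces
    [C *m B = 0], and [M] has the trace of [C *m B]. *)
Lemma mxtrace_sqr0 (F : fieldType) n (M : 'M[F]_n) : M *m M = 0 -> \tr M = 0.
Proof.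
move=> M2; rewrite -(mulmx_base M) mxtrace_mulC.
suff -> : row_base M *m col_base M = 0 by rewrite mxtrace0.
apply: (row_full_inj (col_base_full M)); apply: (row_free_inj (row_base_free M)).
by rewrite mulmx0 mul0mx (mulmxA (col_base M)) mulmx_base -mulmxA mulmx_base.
Qed.

(** If an eigenvalue [l] is at least double, the characteristic polynomial is
    [('X - l)^2 * h].  By Cayley-Hamilton the product of the value at [K] of
    [g = ('X - l) * h] and of any power of [K] has square zero, hence trace
    zero: the coefficients of [g] are a linear relation between the rows of
    the matrix of traces. *)
Lemma trace_form_det_diagonalizable (C : closedFieldType) n (K : 'M[C]_n) :
  trace_form_det K != 0 -> exists WL, eigendecomposition K WL.
Proof.
case: n K => [|n] K D0.
  by exists (1%:M, 0); split; [rewrite unitmx1 | apply/matrixP => -[]].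
have [rs Ers] := closed_field_poly_normal (char_poly K).
rewrite (monicP (char_poly_monic K)) scale1r in Ers.
have rsu : uniq rs.
  apply: contraNT D0 => /(uniqPn 0)[i [j [ij js eij]]].
  pose l := rs`_i.
  have [h Eh] : exists h, char_poly K = ('X - l%:P) * (('X - l%:P) * h).
    have irs : (i < size rs)%N by apply: ltn_trans js.
    have lrs' : l \in rem l rs.
      rewrite -has_pred1 has_count count_rem; rewrite (_ : l \in rs) ?mem_nth //.
      rewrite /= eqxx subn_gt0 -(cat_take_drop j rs) count_cat.
      apply: (@leq_add 1 1); rewrite -has_count has_pred1.
        rewrite /l -(nth_take 0 ij); apply: mem_nth.
        by rewrite size_take js.
      by rewrite (drop_nth 0 js) inE -eij eqxx.
    exists (\prod_(z <- rem l (rem l rs)) ('X - z%:P)).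
    rewrite Ers (perm_big _ (perm_to_rem (mem_nth 0 irs))) big_cons /=.
    by rewrite (perm_big _ (perm_to_rem lrs')) big_cons.
  pose g := ('X - l%:P) * h.
  have szg : size g = n.+1.
    have g0 : g != 0.
      apply: contraTneq (char_poly_monic K) => g0; rewrite Eh -/g g0 mulr0.
      by rewrite monicE lead_coef0 eq_sym oner_eq0.
    have := size_char_poly K; rewrite Eh -/g size_monicM ?monicXsubC //.
    by rewrite size_XsubC => -[].
  have g0 : g != 0 by rewrite -size_poly_eq0 szg.
  have tr0 k : \tr (horner_mx K g *m K ^+ k) = 0.
    apply: mxtrace_sqr0.
    have -> : K ^+ k = horner_mx K 'X^k by rewrite rmorphXn /= horner_mx_X.
    rewrite -[_ *m horner_mx K 'X^k]/(horner_mx K g * horner_mx K 'X^k) -rmorphM.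
    rewrite -[_ *m _]/(horner_mx K (g * 'X^k) * horner_mx K (g * 'X^k)) -rmorphM.
    have -> : g * 'X^k * (g * 'X^k) = char_poly K * (h * 'X^k * 'X^k).
      rewrite Eh /g; move: ('X - l%:P) ('X^k) => x y.
      by rewrite mulrACA -!mulrA (mulrCA h x).
    by rewrite rmorphM /= Cayley_Hamilton mul0r.
  apply/det0P; exists (\row_i g`_i).
    apply: contraNneq g0 => /rowP e; apply/eqP/polyP => k; rewrite coef0.
    case: (ltnP k n.+1) => [kn|nk]; last by rewrite nth_default // szg.
    by have := e (Ordinal kn); rewrite !mxE.
  apply/rowP => k; rewrite !mxE -[RHS](tr0 k).
  have -> : horner_mx K g = \sum_(i < n.+1) g`_i *: K ^+ i.
    rewrite -{1}[g]coefK poly_def szg raddf_sum; apply: eq_bigr => e _.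
    by rewrite /= horner_mxZ rmorphXn /= horner_mx_X.
  rewrite mulmx_suml raddf_sum /=; apply: eq_bigr => e _.
  by rewrite !mxE -scalemxAl mxtraceZ exprD.
have /diagonalizableP[] : exists2 rs, uniq rs &
    mxminpoly K %| \prod_(x <- rs) ('X - x%:P).
  by exists rs => //; rewrite -Ers mxminpoly_dvd_char.
move=> P Pu /(diagonalizable_forLR Pu)[y Ey].
exists (invmx P, y); split; first by rewrite unitmx_inv.
by rewrite [LHS]Ey mxpoly.conjumx ?unitmx_inv.
Qed.

End TraceForm.

(** * Gram-Schmidt orthonormalization for an abstract conjugation *)

Section GramSchmidt.
Variables (F : fieldType) (cj : {rmorphism F -> F}) (m : nat).
Hypothesis cjK : involutive cj.
Hypothesis normalizable : forall v : 'rV[F]_m, v != 0 ->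
  exists t, t * cj t * (v *m (map_mx cj v)^T) 0 0 = 1.

(** The hypotheses hold for the identity of the reals and for complex
    conjugation alike; [normalizable] says that nonzero vectors can be rescaled
    to unit length. *)
Lemma gram_schmidt n (A : 'M[F]_(n, m)) : row_free A ->
  exists2 B : 'M[F]_(n, m), B *m (map_mx cj B)^T = 1%:M & (B == A)%MS.
Proof.
elim: n A => [|n IH] A Af.
  by exists 0; [apply/matrixP => -[] | rewrite (flatmx0 A) submx_refl].
pose a : 'M_(1, m) := usubmx (A : 'M_(1 + n, m)).
pose A' : 'M_(n, m) := dsubmx (A : 'M_(1 + n, m)).
have EA : A = col_mx a A' :> 'M_(1 + n, m) by rewrite vsubmxK.
have /row_freeP[V AV] := Af.
have [aV A'V] : a *m V = row_mx 1%:M 0 :> 'M_(1, 1 + n) /\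
    A' *m V = row_mx 0 1%:M :> 'M_(n, 1 + n).
  apply: (@eq_col_mx _ 1 n (1 + n)); rewrite -mul_col_mx -EA.
  by rewrite -block_mxEv -scalar_mx_block.
have [|B B1 /eqmxP BA'] := IH A'.
  apply/row_freeP; exists (V *m (col_mx 0 1%:M : 'M_(1 + n, n))).
  rewrite mulmxA A'V.
  have := mul_row_col (0 : 'M[F]_(n, 1)) (1%:M : 'M_n)
            (0 : 'M_(1, n)) (1%:M : 'M_n).
  by rewrite mul0mx mulmx1 add0r.
pose v := a - a *m (map_mx cj B)^T *m B.
have vB : v *m (map_mx cj B)^T = 0.
  by rewrite mulmxBl -!mulmxA B1 mulmx1 subrr.
have Bv : B *m (map_mx cj v)^T = 0.
  have := congr1 (fun M => map_mx cj M^T) vB.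
  rewrite trmx_mul trmxK map_mxM trmx0 map_mx0.
  by rewrite -map_mx_comp map_mx_id // map_trmx.
have v0 : v != 0.
  apply/eqP => v0; have : (a <= A')%MS.
    rewrite -BA' -[a](subrK (a *m (map_mx cj B)^T *m B)) -/v v0 add0r.
    exact: submxMl.
  case/submxP => c Ea; move: aV; rewrite Ea -mulmxA A'V.
  rewrite [LHS](mul_mx_row c (0 : 'M_(n, 1)) (1%:M : 'M_n)) mulmx0.
  case/eq_row_mx => /matrixP/(_ 0 0) + _; rewrite !mxE => /eqP.
  by rewrite eq_sym oner_eq0.
have [t ht] := normalizable v0.
have t0 : t != 0 by apply: contra_eq_neq ht => ->; rewrite !mul0r eq_sym oner_eq0.
pose B' : 'M_(1 + n, m) := col_mx (t *: v) B.
have B'1 : B' *m (map_mx cj B')^T = 1%:M.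
  rewrite map_col_mx tr_col_mx mul_col_row B1.
  rewrite -(scalemxAl t v (map_mx cj B)^T) vB scaler0 map_mxZ linearZ /=.
  rewrite -(scalemxAr (cj t) B) Bv scaler0.
  rewrite -scalemxAl -scalemxAr scalerA scalar_mx_block.
  have -> : (t * cj t) *: (v *m (map_mx cj v)^T) = 1%:M.
    by apply/matrixP => i j; rewrite !ord1 mxE ht mxE.
  by [].
exists B' => //.
have Brank : \rank B' = n.+1.
  apply/eqP; rewrite -[_ == _]/(row_free B'); apply/row_freeP.
  by eexists; exact: B'1.
have BB' : (B <= B')%MS by rewrite -addsmxE addsmxSr.
have AB' : (A <= B')%MS.
  suff : (col_mx a A' <= B')%MS by rewrite -EA.
  rewrite col_mx_sub -BA' BB' andbT.
  rewrite -[a](subrK (a *m (map_mx cj B)^T *m B)) -/v addmx_sub //.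
    rewrite -[v]scale1r -(mulVf t0) -scalerA scalemx_sub // -addsmxE.
    exact: addsmxSl.
  by rewrite mulmx_sub.
by rewrite AB' andbT -(geq_leqif (mxrank_leqif_sup AB')) Brank (eqP Af).
Qed.

End GramSchmidt.

Lemma hermitian_norm_gt0 (F : numFieldType) (cj : {rmorphism F -> F}) m
    (v : 'rV[F]_m) :
  (forall x, x * cj x = `|x| ^+ 2) -> v != 0 -> 0 < (v *m (map_mx cj v)^T) 0 0.
Proof.
move=> cjN v0; have [i vi] : exists i, v 0 i != 0.
  apply/existsP; apply: contraR v0 => /existsPn h.
  by apply/eqP/rowP => i; rewrite mxE; apply/eqP/negbNE/h.
rewrite mxE (bigD1 i) //= !mxE cjN ltr_pwDl ?exprn_gt0 ?normr_gt0 //.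
by apply: sumr_ge0 => j _; rewrite !mxE cjN exprn_ge0.
Qed.

(** * Gradings of the coordinates, transported along a change of basis *)

Section Grading.
Variables (F : fieldType) (n r : nat).
Implicit Types (g : 'I_n -> 'I_r) (M : 'M[F]_n).

(** A map [g] from indices to blocks grades the coordinate space; homogeneous
    matrices preserve the grading.  Block diagonal matrices are the case of the
    standard grouping of indices; the eigenvectors computed by the algorithm
    give a grading with no prescribed order of the indices. *)
Definition homogeneous g M := forall a b, g a != g b -> M a b = 0.

Definition grading_proj g (i : 'I_r) : 'M[F]_n := diag_mx (\row_a (g a == i)%:R).

Lemma homogeneousP g M :
  homogeneous g M <-> forall i, grading_proj g i *m M = M *m grading_proj g i.
Proof.
split=> [h i|h a b gab].
  apply/matrixP => a b; rewrite mul_diag_mx mul_mx_diag !mxE.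
  have [->|/h ->] := eqVneq (g a) (g b); first by rewrite mulrC.
  by rewrite mulr0 mul0r.
have /matrixP/(_ a b) := h (g a); rewrite mul_diag_mx mul_mx_diag !mxE eqxx.
by rewrite mul1r eq_sym (negPf gab) mulr0.
Qed.

Lemma trace_grading_proj g M i :
  \tr (grading_proj g i *m M) = \sum_(a | g a == i) M a a.
Proof.
rewrite big_mkcond; apply: eq_bigr => a _; rewrite mul_diag_mx !mxE.
by case: eqP; rewrite ?mul1r ?mul0r.
Qed.

End Grading.

(** In this section the columns of [H] form a basis of homogeneous vectors,
    the column [a] being of degree [h a] for the grading [g]. *)
Section Regrading.
Variables (F : fieldType) (n r : nat) (g h : 'I_n -> 'I_r) (H : 'M[F]_n).
Hypothesis Hu : H \in unitmx.
Hypothesis Hgh : forall i,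
  invmx H *m grading_proj F g i *m H = grading_proj F h i.

Lemma regrading_homogeneous M :
  homogeneous g M <-> homogeneous h (invmx H *m M *m H).
Proof.
rewrite !homogeneousP.
have e i : grading_proj F h i *m (invmx H *m M *m H) =
    invmx H *m (grading_proj F g i *m M) *m H.
  by rewrite -Hgh !mulmxA mulmxK.
have e' i : (invmx H *m M *m H) *m grading_proj F h i =
    invmx H *m (M *m grading_proj F g i) *m H.
  by rewrite -Hgh !mulmxA mulmxK.
split=> c i; first by rewrite e e' c.
have := c i; rewrite e e' => /(row_free_inj _) ; rewrite row_free_unit => /(_ Hu).
by apply: row_full_inj; rewrite row_full_unit unitmx_inv.
Qed.

Lemma regrading_trace M i :
  \sum_(a | h a == i) (invmx H *m M *m H) a a = \sum_(a | g a == i) M a a.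
Proof.
rewrite -!trace_grading_proj -Hgh -!mulmxA (mulKVmx Hu) mxtrace_mulC.
by rewrite -!mulmxA mulmxV // mulmx1.
Qed.

End Regrading.

(** Both numbers are equal in [F] to the trace of the projection onto the part
    of degree [i]. *)
Lemma regrading_card (F : numFieldType) (n r : nat) (g h : 'I_n -> 'I_r)
    (H : 'M[F]_n) : H \in unitmx ->
  (forall i, invmx H *m grading_proj F g i *m H = grading_proj F h i) ->
  forall i, #|[pred a | h a == i]| = #|[pred a | g a == i]|.
Proof.
move=> Hu Hgh i; have := regrading_trace Hu Hgh 1%:M i.
rewrite mulmx1 mulVmx //.
have tr1 (f : 'I_n -> 'I_r) :
    \sum_(a | f a == i) (1%:M : 'M[F]_n) a a = (#|[pred a | f a == i]|)%:R.
  by rewrite (eq_bigr (fun=> 1)) ?sumr_const // => a _; rewrite mxE eqxx.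
by rewrite !tr1 => /eqP; rewrite eqr_nat => /eqP.
Qed.

(** The projections of the grading commute with [Y], so in a basis of
    eigenvectors of [Y] with distinct eigenvalues they become diagonal.  A
    nonzero coordinate of an eigenvector then determines the only degree in
    which it has a component. *)
Lemma simple_spectrum_regrading (F : fieldType) (n r : nat) (g : 'I_n -> 'I_r)
    (H Y : 'M[F]_n) (y : 'rV[F]_n) :
  H \in unitmx -> injective (y 0) -> Y *m H = H *m diag_mx y -> homogeneous g Y ->
  exists h : 'I_n -> 'I_r,
    forall i, invmx H *m grading_proj F g i *m H = grading_proj F h i.
Proof.
move=> Hu yi YH gY.
pose N i := invmx H *m grading_proj F g i *m H.
have HN i : grading_proj F g i *m H = H *m N i.
  by rewrite /N !mulmxA mulmxV // mul1mx.
have Ndiag i a b : a != b -> N i a b = 0.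
  move=> ab; have : N i *m diag_mx y = diag_mx y *m N i.
    have YH' : invmx H *m Y = diag_mx y *m invmx H.
      by rewrite -[Y](mulmxK Hu) YH !mulmxA mulVmx // mul1mx.
    rewrite /N -!mulmxA -YH (mulmxA (diag_mx y)) -YH' -!mulmxA.
    congr (_ *m _); rewrite !mulmxA; congr (_ *m _).
    by move/homogeneousP: gY => ->.
  rewrite mul_mx_diag mul_diag_mx => /matrixP/(_ a b); rewrite !mxE mulrC => /eqP.
  rewrite -subr_eq0 -mulrBl mulf_eq0 subr_eq0 => /orP[/eqP/yi|/eqP //].
  by move/eqP; rewrite eq_sym (negPf ab).
have HNe i b a : (g b == i)%:R * H b a = H b a * N i a a.
  have /matrixP/(_ b a) := HN i.
  rewrite mul_diag_mx [LHS]mxE [X in X * _ = _]mxE [RHS]mxE (bigD1 a) //=.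
  by rewrite big1 ?addr0 // => c ca; rewrite Ndiag ?mulr0.
have nz a : exists b, H b a != 0.
  apply/existsP; apply: contraT => /existsPn H0; move: Hu.
  rewrite unitmxE (expand_det_col _ a) big1 ?unitr0 // => b _.
  by have := H0 b; rewrite negbK => /eqP ->; rewrite mul0r.
have [p hp] := fin_all_exists nz.
exists (fun a => g (p a)) => i; apply/matrixP => a b.
rewrite -/(N i) [RHS]mxE [X in X *+ _]mxE.
case: (eqVneq a b) => [<-|/Ndiag ->]; last by rewrite mulr0n.
rewrite mulr1n; apply: (mulfI (hp a)); rewrite -HNe; exact: mulrC.
Qed.

(** * Grouping the eigenvectors into blocks *)

Definition block_index (r d : nat) (a : 'I_(r * d)) : 'I_r * 'I_d :=
  enum_val (cast_ord (esym (mxvec_cast r d)) a).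

Definition block_of (r d : nat) (a : 'I_(r * d)) : 'I_r := (block_index a).1.

Lemma block_indexK (r d : nat) (i : 'I_r) (k : 'I_d) :
  block_index (mxvec_index i k) = (i, k).
Proof. by rewrite /block_index /mxvec_index cast_ordK enum_rankK. Qed.

Lemma block_of_index (r d : nat) (i : 'I_r) (k : 'I_d) :
  block_of (mxvec_index i k) = i.
Proof. by rewrite /block_of block_indexK. Qed.

Lemma block_diagonalP (F : fieldType) (r d : nat) (M : 'M[F]_(r * d)) :
  block_diagonal M <-> homogeneous (@block_of r d) M.
Proof.
split=> [h a b|h i j k l ij]; last by rewrite h // !block_of_index.
have [i [k ->]] := mxvec_index_surj a; have [j [l ->]] := mxvec_index_surj b.
by rewrite !block_of_index => /h.
Qed.

Lemma conj_perm_mxE (F : fieldType) n (s : 'S_n) (M : 'M[F]_n) a b :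
  ((perm_mx s)^T *m M *m perm_mx s) a b = M (s^-1%g a) (s^-1%g b).
Proof.
by rewrite tr_perm_mx -row_permE -[s in perm_mx s]invgK -col_permE !mxE.
Qed.

(** The two gradings have the same number of indices in each degree, so a
    permutation of the indices carries one to the other. *)
Lemma exists_block_diagonalizing (F : fieldType) (r d : nat)
    (K W : 'M[F]_(r * d)) (h : 'I_(r * d) -> 'I_r) :
  (forall i, #|[pred a | h a == i]| = #|[pred a | @block_of r d a == i]|) ->
  homogeneous h (invmx W *m K *m W) ->
  exists P, block_diagonalizing K W P.
Proof.
move=> hc hM; set M := invmx W *m K *m W in hM.
have /tuple_permP[p hp] : perm_eq [tuple @block_of r d a | a < r * d]
    [tuple h a | a < r * d].
  apply/allP => i _.
  have cE (f : 'I_(r * d) -> 'I_r) :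
      count_mem i [tuple f a | a < r * d] = #|[pred a | f a == i]|.
    rewrite cardE /enum_mem size_filter !count_map.
    by apply: eq_count => a /=; rewrite inE.
  by apply/eqP; rewrite !cE hc.
have {}hp a : block_of a = h (p a).
  by have /val_inj/(congr1 (fun t => tnth t a)) := hp; rewrite !tnth_mktuple.
exists (perm_mx p^-1); split; first exact: perm_mx_is_perm.
apply/block_diagonalP => a b ab.
rewrite -!mulmxA (mulmxA K) (mulmxA (invmx W)) mulmxA (mulmxA _ K) -/M.
by rewrite conj_perm_mxE invgK hM // -!hp.
Qed.

(** Block diagonality forces indices of the same degree for [h] into the same
    block.  This defines a map from degrees to blocks; it is onto since no block
    is empty, hence bijective, so that conversely a block receives the indices
    of a single degree. *)
Lemma block_diagonalizing_regroups (F : fieldType) (r d : nat)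
    (K W P : 'M[F]_(r * d)) (h : 'I_(r * d) -> 'I_r) :
  (0 < d)%N ->
  (forall a b, a != b -> h a = h b -> (invmx W *m K *m W) a b != 0) ->
  block_diagonalizing K W P ->
  exists (p : 'S_(r * d)) (t : 'S_r),
    P = perm_mx p^-1 /\ forall i k, h (p (mxvec_index i k)) = t i.
Proof.
move=> d0 Mnz [/is_perm_mxP[s ->] /block_diagonalP Md].
set M := invmx W *m K *m W in Mnz.
have hb a b : h (s^-1%g a) = h (s^-1%g b) -> block_of a = block_of b.
  move=> e; apply: contraTeq isT => ab.
  have sab : s^-1%g a != s^-1%g b.
    by rewrite (inj_eq perm_inj); apply: contraNneq ab => ->.
  have := Mnz _ _ sab e; rewrite -(conj_perm_mxE s) /M !mulmxA Md ?eqxx //.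
pose f (c : 'I_r) :=
  if [pick a | h (s^-1%g a) == c] is Some a then block_of a else c.
have fE a : f (h (s^-1%g a)) = block_of a.
  rewrite /f; case: pickP => [b /eqP /hb //|/(_ a)].
  by rewrite eqxx.
pose a0 i : 'I_(r * d) := mxvec_index i (Ordinal d0).
have finj : injective f.
  have : injective (fun i => h (s^-1%g (a0 i))).
    by move=> i j /hb; rewrite !block_of_index.
  move=> /injF_bij [g' gK Kg] i j; rewrite -(Kg i) -(Kg j) !fE !block_of_index.
  by move=> ->.
exists s^-1%g, (perm finj)^-1%g; split; first by rewrite invgK.
move=> i k; apply: (@perm_inj _ (perm finj)).
by rewrite permKV permE fE block_of_index.
Qed.

(** The i-th group of eigenvectors is a basis of the span of block [t i] of
    columns of [G], so the two wedges differ by the determinant of the change of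
    basis, whose inverse is the coefficient [x i]. *)
Lemma solvable_regrouped (F : fieldType) (r d : nat) (G W : 'M[F]_(r * d))
    (h : 'I_(r * d) -> 'I_r) (p : 'S_(r * d)) (t : 'S_r) :
  G \in unitmx -> W \in unitmx ->
  (forall i, invmx (invmx G *m W) *m grading_proj F (@block_of r d) i *m
     (invmx G *m W) = grading_proj F h i) ->
  (forall i k, h (p (mxvec_index i k)) = t i) ->
  exists x, solves_for (block_col (W *m perm_mx p^-1))
    (\sum_(i < r) wedge (block_col G i)) x.
Proof.
move=> Gu Wu; set H := invmx G *m W => Hgr hp.
have Hu : H \in unitmx by rewrite unitmx_mul unitmx_inv Gu.
have Hsupp a b : block_of b != h a -> H b a = 0.
  move=> ba; have /matrixP/(_ b a) : grading_proj F (@block_of r d) (h a) *m H =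
     H *m grading_proj F h (h a) by rewrite -Hgr !mulmxA mulmxV // mul1mx.
  by rewrite mul_diag_mx mul_mx_diag !mxE (negPf ba) eqxx mul0r mulr1.
pose M (i : 'I_r) : 'M[F]_d :=
  \matrix_(l, k) H (mxvec_index (t i) l) (p (mxvec_index i k)).
have wE i : wedge (block_col (W *m perm_mx p^-1) i) =
    \det (M i) *: wedge (block_col G (t i)).
  rewrite -wedge_change_of_basis; apply: eq_wedge => k.
  have -> : W = G *m H by rewrite /H mulKVmx.
  apply/matrixP => a b; rewrite ord1 -col_permE !mxE summxE big_mxvec_index.
  rewrite (bigD1 (t i)) //= [X in _ + X]big1 ?addr0 => [|j jt].
    apply: eq_bigr => l _.
    by rewrite [RHS]mxE [M _ _ _]mxE [col _ _ _ _]mxE mulrC.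
  by apply: big1 => l _; rewrite Hsupp ?mulr0 // hp block_of_index.
have M0 i : \det (M i) != 0.
  rewrite -det_tr; apply/negP => /det0P [u u0 uM].
  pose z : 'rV[F]_(r * d) := \row_a \sum_k u 0 k * (a == p (mxvec_index i k))%:R.
  have zH : z *m H^T = 0.
    apply/rowP => b; rewrite !mxE.
    transitivity (\sum_k u 0 k * H b (p (mxvec_index i k))).
      transitivity (\sum_a \sum_k u 0 k * (a == p (mxvec_index i k))%:R * H b a).
        by apply: eq_bigr => a _; rewrite !mxE mulr_suml.
      rewrite exchange_big; apply: eq_bigr => k _ /=.
      rewrite (bigD1 (p (mxvec_index i k))) //= eqxx mulr1 big1 ?addr0 // => a ak.
      by rewrite (negPf ak) mulr0 mul0r.
    have [j [l ->]] := mxvec_index_surj b.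
    have [->|jt] := eqVneq j (t i); last first.
      by apply: big1 => k _; rewrite Hsupp ?mulr0 // hp block_of_index.
    have /matrixP/(_ 0 l) := uM; rewrite !mxE => uMl; rewrite -[RHS]uMl.
    by apply: eq_bigr => k _; rewrite !mxE.
  have HTu : H^T \in unitmx by rewrite unitmx_tr.
  have z0 : z = 0 by rewrite -(mulmxK HTu z) zH mul0mx.
  case/eqP: u0; apply/rowP => k; rewrite mxE.
  have /rowP/(_ (p (mxvec_index i k))) := z0; rewrite !mxE => zk; rewrite -[RHS]zk.
  rewrite (bigD1 k) //= eqxx mulr1 big1 ?addr0 // => l lk.
  by rewrite (inj_eq perm_inj) mxvec_index_inj eqxx eq_sym (negPf lk) mulr0.
exists (fun i => (\det (M i))^-1); rewrite /solves_for.
rewrite [RHS](reindex_inj (@perm_inj _ t)); apply: eq_bigr => i _.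
by rewrite wE scalerA mulVf // scale1r.
Qed.

(** * Zariski closed sets over the base field cut out by complex polynomials *)

(** Nonvanishing at a point [a + w * b] with [w] in the extension field yields
    nonvanishing at some [a + t * b] with [t] a natural number. *)
Lemma meval_on_line (C : comNzRingType) N (p : {mpoly C[N]}) (a b : 'I_N -> C) :
  exists u : {poly C}, forall t, u.[t] = p.@[fun i => a i + t * b i].
Proof.
exists (\sum_(m <- msupp p) p@_m *: \prod_i ((a i)%:P + 'X * (b i)%:P) ^+ m i).
move=> t; rewrite mevalE horner_sum; apply: eq_bigr => m _.
rewrite hornerZ horner_prod; congr (_ * _); apply: eq_bigr => i _.
by rewrite !hornerE.
Qed.

Definition generic_mx (C : comNzRingType) n : 'M[{mpoly C[n * n]}]_n :=
  vec_mx (\row_e 'X_e).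

Lemma meval_generic_mx (C : comNzRingType) n (Y : 'M[C]_n) :
  map_mx (meval (mxvec Y 0)) (generic_mx C n) = Y.
Proof.
rewrite -[RHS]mxvecK map_vec_mx; congr vec_mx; apply/rowP => e.
by rewrite !mxE mevalXU.
Qed.

(** Such a diagonal is given by distinct positive integers except at the first
    place of each block, where the opposite of the sum of the others stands;
    these sums increase with the block. *)
Lemma exists_traceless_simple (C : numDomainType) (r d : nat) : (1 < d)%N ->
  exists y : 'rV[C]_(r * d), injective (y 0) /\
    forall i : 'I_r, \sum_(k < d) y 0 (mxvec_index i k) = 0.
Proof.
case: d => // d d1; pose s := (\sum_(k < d) k.+1)%N.
pose f (p : 'I_r * 'I_d.+1) : int :=
  if p.2 == ord0 then - (p.1 * (d * d.+1) + s)%:Z else (p.1 * d.+1 + p.2)%:Z.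
have fi : injective f.
  move=> [i k] [j l]; rewrite /f /=.
  have [->|k0] := eqVneq k ord0; have [->|l0] := eqVneq l ord0.
  - move=> /oppr_inj [] /addIn/eqP; rewrite eqn_pmul2r ?muln_gt0 ?andbT //.
    by move=> /eqP/val_inj ->.
  - move=> /eqP; rewrite -subr_eq0 -opprD oppr_eq0 -PoszD.
    rewrite eqz_nat !addn_eq0 => /andP[_ /andP[_ /eqP l00]].
    by case/eqP: l0; apply: val_inj.
  - move=> /eqP; rewrite -subr_eq0 opprK -PoszD.
    rewrite eqz_nat !addn_eq0 => /andP[/andP[_ /eqP k00] _].
    by case/eqP: k0; apply: val_inj.
  - move=> [] e; have ij : i = j :> nat.
      by have := congr1 (divn^~ d.+1) e; rewrite /= !divnMDl // !divn_small ?addn0.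
    by move: e; rewrite ij => /addnI/val_inj ->; rewrite (val_inj ij).
exists (\row_a (f (block_index a))%:~R); split.
  move=> a b; rewrite !mxE => /eqP; rewrite eqr_int => /eqP/fi.
  by move/enum_val_inj/cast_ord_inj.
move=> i; under eq_bigr do rewrite mxE block_indexK.
rewrite -rmorph_sum big_ord_recl /f /=.
have -> : \sum_(k < d) (i * d.+1 + bump 0 k)%:Z = (i * (d * d.+1) + s)%:Z.
  rewrite -(big_morph Posz PoszD (erefl _)) big_split /= sum_nat_const card_ord.
  by rewrite mulnCA.
by rewrite addNr rmorph0.
Qed.

Lemma deltaE (F : fieldType) n d (A : tensor F n d) (X : 'M[F]_n)
    (i : multi_index n d) :
  delta A X i = \sum_(k < d) \sum_(j : multi_index n d) X (i k) (j k) *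
    (\prod_(l < d | l != k) ((1%:M : 'M[F]_n) (i l) (j l)) * A j).
Proof.
rewrite /delta sum_ffunE; apply: eq_bigr => k _; rewrite ffunE.
apply: eq_bigr => j _; rewrite mulrA; congr (_ * _).
rewrite (bigD1 k) //= eqxx; congr (_ * _).
by apply: eq_bigr => l /negPf ->.
Qed.

Definition base_linear (F C : fieldType) (iota : F -> C) (f : C -> F) : Prop :=
  forall a z z', f (iota a * z + z') = a * f z + f z'.

Section Extension.
Variables (F : fieldType) (C : numClosedFieldType) (iota : {rmorphism F -> C}).
Variables (re im : C -> F) (w : C).
Hypothesis reL : base_linear iota re.
Hypothesis imL : base_linear iota im.
Hypothesis reim : forall z, z = iota (re z) + w * iota (im z).

Lemma base_linear0 (f : C -> F) : base_linear iota f -> f 0 = 0.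
Proof.
move=> fL; have := fL 1 0 0; rewrite rmorph1 !mul1r addr0 => /eqP.
by rewrite -subr_eq0 opprD addrA subrr sub0r oppr_eq0 => /eqP.
Qed.

Lemma base_linear_sum (f : C -> F) : base_linear iota f ->
  forall (I : Type) (s : seq I) (P : pred I) (a : I -> F) (z : I -> C),
  f (\sum_(i <- s | P i) z i * iota (a i)) = \sum_(i <- s | P i) f (z i) * a i.
Proof.
move=> fL I s P a z.
have f0 := base_linear0 fL.
elim/big_ind2: _ => // [x1 x2 y1 y2 <- <-|i _].
  by have := fL 1 x2 y2; rewrite rmorph1 !mul1r.
by rewrite mulrC -[_ * _]addr0 fL f0 addr0 mulrC.
Qed.

Definition mpoly_component (f : C -> F) N (p : {mpoly C[N]}) : {mpoly F[N]} :=
  \sum_(m <- msupp p) f p@_m *: 'X_[m].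

Lemma meval_component (f : C -> F) : base_linear iota f ->
  forall N (p : {mpoly C[N]}) (a : 'I_N -> F),
  (mpoly_component f p).@[a] = f p.@[fun i => iota (a i)].
Proof.
move=> fL N p a; rewrite /mpoly_component rmorph_sum /= [in RHS]mevalE.
rewrite (eq_bigr (fun m => p@_m * iota (\prod_i a i ^+ m i))); last first.
  move=> m _; rewrite rmorph_prod; congr (_ * _).
  by apply: eq_bigr => i _; rewrite rmorphXn.
rewrite base_linear_sum //; apply: eq_bigr => m _.
by rewrite mevalZ mevalX.
Qed.

(** The zero set is cut out over [F] by the two components of the polynomial,
    rewritten in terms of the coordinates in the chosen basis.  The hypothesis
    on the functions [l j] says that they are linear forms. *)
Lemma zero_set_closed (V : vectType F) N (l : 'I_N -> V -> F) (p : {mpoly C[N]}) :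
  (forall j v, l j v = \sum_k coord (vbasis {:V}) k v * l j (vbasis {:V})`_k) ->
  zariski_closed (fun v => p.@[fun j => iota (l j v)] = 0).
Proof.
move=> hl.
pose q := p \mPo
  [tuple \sum_(k < \dim {:V}) iota (l j (vbasis {:V})`_k) *: 'X_k | j < N].
have qE v : q.@[fun k => iota (coord (vbasis {:V}) k v)] =
    p.@[fun j => iota (l j v)].
  rewrite comp_mpoly_meval; apply: meval_eq => j; rewrite tnth_mktuple.
  rewrite hl !rmorph_sum; apply: eq_bigr => k _ /=.
  by rewrite mevalZ mevalXU rmorphM mulrC.
exists (fun g => g = mpoly_component re q \/ g = mpoly_component im q) => v.
rewrite -qE; split=> [q0 _ [] ->|h]; rewrite /poly_fun.
- by rewrite meval_component // q0 base_linear0.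
- by rewrite meval_component // q0 base_linear0.
rewrite [LHS]reim -!meval_component //.
have := h _ (or_introl erefl); have := h _ (or_intror erefl).
by rewrite /poly_fun => -> ->; rewrite rmorph0 mulr0 addr0.
Qed.

Section Kappa.
Variables (n d : nat) (A : tensor F n d).

Lemma map_kappa K : K \in kappa A -> map_mx iota K \in kappa (map_tensor iota A).
Proof.
rewrite !mem_kappa => /eqP AK; apply/eqP/ffunP => i.
rewrite [RHS]ffunE -[RHS](rmorph0 iota).
have -> : 0 = delta A K i by rewrite AK ffunE.
rewrite !deltaE rmorph_sum; apply: eq_bigr => k _.
rewrite rmorph_sum; apply: eq_bigr => j _.
rewrite !ffunE !mxE !rmorphM rmorph_prod.
congr (_ * (_ * _)); apply: eq_bigr => l _.
by rewrite !mxE rmorphMn rmorph1.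
Qed.

(** [delta (map_tensor iota A)] has its coefficients in [F], so it commutes with
    taking components. *)
Lemma component_kappa (f : C -> F) Y : base_linear iota f ->
  Y \in kappa (map_tensor iota A) -> map_mx f Y \in kappa A.
Proof.
move=> fL; rewrite !mem_kappa => /eqP AY; apply/eqP/ffunP => i.
rewrite [RHS]ffunE -[RHS](base_linear0 fL).
have -> : 0 = delta (map_tensor iota A) Y i by rewrite AY ffunE.
rewrite !deltaE pair_bigA /= [in RHS]pair_bigA /=.
rewrite (eq_bigr (fun kj : 'I_d * multi_index n d => Y (i kj.1) (kj.2 kj.1) * iota
  (\prod_(l < d | l != kj.1) ((1%:M : 'M[F]_n) (i l) (kj.2 l)) * A kj.2))).
  by rewrite base_linear_sum //; apply: eq_bigr => kj _; rewrite !mxE.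
move=> [k j] _ /=; rewrite !ffunE rmorphM rmorph_prod.
congr (_ * (_ * _)); apply: eq_bigr => l _.
by rewrite !mxE rmorphMn rmorph1.
Qed.

(** An open condition met somewhere on the kernel over [C] is met on the kernel
    over [F]: [Y] is a point of the line through the components of [Y], which
    contains elements of the kernel over [F] where the polynomial is nonzero. *)
Lemma generically_in_kappa (p : {mpoly C[n * n]}) (Q : 'M[F]_n -> Prop) :
  (exists2 Y, Y \in kappa (map_tensor iota A) & p.@[mxvec Y 0] != 0) ->
  (forall K, K \in kappa A -> p.@[mxvec (map_mx iota K) 0] != 0 -> Q K) ->
  generically (fun K => K \in kappa A) Q.
Proof.
move=> [Y AY pY] hQ.
have lE K e : mxvec (map_mx iota K) 0 e = iota (mxvec K 0 e).
  by rewrite -map_mxvec mxE.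
exists (fun K => p.@[fun e => iota (mxvec K 0 e)] = 0); split.
- apply: zero_set_closed => e K.
  rewrite {1}(coord_vbasis (memvf K)) linear_sum /= summxE.
  by apply: eq_bigr => k _; rewrite linearZ mxE.
- have [u hu] := meval_on_line p (mxvec (map_mx iota (map_mx re Y)) 0)
                    (mxvec (map_mx iota (map_mx im Y)) 0).
  (* At [t = w] the line passes through [Y]. *)
  have u0 : u != 0.
    apply: contraNneq pY => u0; have := hu w; rewrite u0 horner0 => /esym/eqP.
    congr (_ == 0); apply: meval_eq => e; rewrite !lE.
    have [a [b ->]] := mxvec_index_surj e; by rewrite !mxvecE !mxE -reim.
  have [t ut] := poly_nat_nonroot u0.
  exists (map_mx re Y + t%:R *: map_mx im Y); split.
    by rewrite memvD ?memvZ ?component_kappa.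
  move=> h; move: ut; rewrite hu -[X in _ != X]h => /eqP; apply.
  apply: meval_eq => e; rewrite !lE linearD linearZ /= !mxE.
  by rewrite rmorphD rmorphM rmorph_nat.
- move=> K AK pK; apply: hQ => //; apply/eqP => p0; apply: pK; rewrite -p0.
  by apply: meval_eq => e; rewrite lE.
Qed.

End Kappa.
End Extension.

(** * From the kernel to the decomposition *)

Lemma sum_over_block (F : fieldType) (r d : nat) (Y : 'M[F]_(r * d)) (i : 'I_r) :
  \sum_(a | block_of a == i) Y a a =
  \sum_(k < d) Y (mxvec_index i k) (mxvec_index i k).
Proof.
rewrite big_mkcond big_mxvec_index (bigD1 i) //= [X in _ + X]big1 ?addr0.
  by apply: eq_bigr => k _; rewrite block_of_index eqxx.
by move=> j ji; apply: big1 => k _; rewrite block_of_index (negPf ji).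
Qed.

Section Core.
Variables (F : fieldType) (C : numClosedFieldType) (iota : {rmorphism F -> C}).
Variables (re im : C -> F) (w : C).
Hypothesis reL : base_linear iota re.
Hypothesis imL : base_linear iota im.
Hypothesis reim : forall z, z = iota (re z) + w * iota (im z).
Variables (r d : nat) (A : tensor F (r * d) d) (G : 'M[C]_(r * d)).
Hypotheses (d_gt2 : (2 < d)%N) (Gu : G \in unitmx).
Hypothesis AE : map_tensor iota A = \sum_(i < r) wedge (block_col G i).
Variable Q : ('I_r -> 'I_d -> 'cV[C]_(r * d)) -> ('I_r -> C) -> Prop.
Hypothesis hQ : forall v x, solves_for v (map_tensor iota A) x -> Q v x.

Let dC : d`!%:R != 0 :> C.
Proof. by rewrite pnatr_eq0 -lt0n fact_gt0. Qed.

Lemma map_kappa_homogeneous K : K \in kappa A ->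
  homogeneous (@block_of r d) (invmx G *m map_mx iota K *m G).
Proof.
move=> AK; apply/block_diagonalP/kappa_block_diagonal => //.
by rewrite -AE map_kappa.
Qed.

Lemma mem_kappa_of_homogeneous_traceless (Y : 'M[C]_(r * d)) :
  homogeneous (@block_of r d) (invmx G *m Y *m G) ->
  (forall i : 'I_r, \sum_(a | block_of a == i) (invmx G *m Y *m G) a a = 0) ->
  Y \in kappa (map_tensor iota A).
Proof.
move=> /block_diagonalP Yb Ytr; rewrite AE; apply: traceless_blocks_kappa => //.
by move=> i; rewrite -sum_over_block Ytr.
Qed.

Lemma exists_simple_kappa :
  exists2 Y : 'M[C]_(r * d), Y \in kappa (map_tensor iota A) &
    trace_form_det Y != 0.
Proof.
have [y [yi y0]] := exists_traceless_simple C r (ltnW d_gt2).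
exists (G *m diag_mx y *m invmx G); last first.
  by rewrite trace_form_det_conj //; apply/trace_form_det_diag_neq0.
have GY : invmx G *m (G *m diag_mx y *m invmx G) *m G = diag_mx y.
  by rewrite !mulmxA mulVmx // mul1mx mulmxKV.
apply: mem_kappa_of_homogeneous_traceless => [a b ab|i]; rewrite GY.
  rewrite mxE; have [e|_] := eqVneq a b; last by rewrite mulr0n.
  by rewrite e eqxx in ab.
rewrite sum_over_block -[RHS](y0 i); apply: eq_bigr => k _.
by rewrite mxE eqxx mulr1n.
Qed.

(** Simple spectrum of [K] is the nonvanishing of [trace_form_det].  Once an
    eigenbasis [W] of [K] is given, the condition on [K'] is the nonvanishing
    of all entries of [K'] in this basis that the grading [h] of the
    eigenvectors allows, the diagonal excepted.  This condition can be met: the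
    matrix with all these entries equal to 1 and zero diagonal is traceless on
    each block, so it belongs to the kernel. *)
Lemma kernel_steps_decompose :
  generically (fun K => K \in kappa A) (fun K =>
  step (eigendecomposition (map_mx iota K)) (fun WL =>
  generically (fun K' => K' \in kappa A) (fun K' =>
  step (block_diagonalizing (map_mx iota K') WL.1) (fun P =>
  step (solves_for (block_col (WL.1 *m P)) (map_tensor iota A))
    (Q (block_col (WL.1 *m P))))))).
Proof.
apply: (generically_in_kappa reL imL reim
  (p := trace_form_det (generic_mx C (r * d)))).
  have [Y AY Y0] := exists_simple_kappa; exists Y => //.
  by rewrite map_trace_form_det meval_generic_mx.
move=> K AK; rewrite map_trace_form_det meval_generic_mx => Knz.
split; first exact: trace_form_det_diagonalizable.
move=> [W L] /= [/= Wu KE].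
have Li : injective (L 0).
  by apply/trace_form_det_diag_neq0; move: Knz; rewrite KE trace_form_det_conj.
have [H HE] : exists H, H = invmx G *m W by eexists.
have Hu : H \in unitmx by rewrite HE unitmx_mul unitmx_inv Gu.
have GHW : G *m H = W by rewrite HE mulKVmx.
have [h Hh] : exists h, forall i,
    invmx H *m grading_proj C (@block_of r d) i *m H = grading_proj C h i.
  apply: (simple_spectrum_regrading Hu Li _ (map_kappa_homogeneous AK)).
  by rewrite KE -!mulmxA GHW HE !mulmxA mulmxKV.
have HW Y : invmx H *m (invmx G *m Y *m G) *m H = invmx W *m Y *m W.
  have -> : invmx H *m (invmx G *m Y *m G) *m H = invmx H *m invmx G *m Y *m W.
    by rewrite -GHW !mulmxA.
  congr (_ *m _ *m _); apply: (row_free_inj (A := W)).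
    by rewrite row_free_unit.
  by rewrite /= mulVmx // -[X in _ *m X = _]GHW !mulmxA mulmxKV // mulVmx.
pose M := map_mx (@mpolyC _ C) (invmx W) *m generic_mx C (r * d) *m
  map_mx (@mpolyC _ C) W.
pose p := \prod_(ab : 'I_(r * d) * 'I_(r * d) | (ab.1 != ab.2) && (h ab.1 == h ab.2))
  M ab.1 ab.2.
have pE Y : p.@[mxvec Y 0] =
    \prod_(ab : 'I_(r * d) * 'I_(r * d) | (ab.1 != ab.2) && (h ab.1 == h ab.2))
      (invmx W *m Y *m W) ab.1 ab.2.
  rewrite rmorph_prod; apply: eq_bigr => ab _.
  transitivity (map_mx (meval (mxvec Y 0)) M ab.1 ab.2); first by rewrite [RHS]mxE.
  congr (fun_of_matrix _ _ _); rewrite !map_mxM /= meval_generic_mx -!map_mx_comp.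
  by congr (_ *m _ *m _); apply/matrixP => a b; rewrite mxE /= mevalC.
apply: (generically_in_kappa reL imL reim (p := p)).
  pose J : 'M[C]_(r * d) := \matrix_(a, b) ((a != b) && (h a == h b))%:R.
  have WJ : invmx W *m (W *m J *m invmx W) *m W = J.
    by rewrite !mulmxA mulVmx // mul1mx mulmxKV.
  exists (W *m J *m invmx W).
    apply: mem_kappa_of_homogeneous_traceless => [|i].
      apply/(regrading_homogeneous Hu Hh); rewrite HW WJ => a b ab.
      by rewrite mxE (negPf ab) andbF.
    rewrite -(regrading_trace Hu Hh) HW WJ big1 // => a _.
    by rewrite mxE eqxx.
  rewrite pE WJ; apply/prodf_neq0 => -[a b] /= ab.
  by rewrite mxE ab oner_eq0.
move=> K' AK'; rewrite pE => /prodf_neq0 Mnz.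
split.
  apply: exists_block_diagonalizing (regrading_card Hu Hh) _.
  by rewrite -HW; apply/(regrading_homogeneous Hu Hh)/map_kappa_homogeneous.
move=> P /block_diagonalizing_regroups Pb.
have [||p' [t [-> hp]]] := Pb h; first exact: ltnW (ltnW d_gt2).
  by move=> a b ab hab; apply: (Mnz (a, b)); rewrite /= ab hab eqxx.
split=> [|x]; last exact: hQ.
by rewrite AE; rewrite HE in Hh; apply: solvable_regrouped hp.
Qed.

End Core.

(** * The first flattening, and the parametrization of sums of wedges *)

Section Flattening.
Variables (F : fieldType) (m d r : nat) (k0 : 'I_d).

Definition columns_mx (v : 'I_r -> 'I_d -> 'cV[F]_m) : 'M[F]_(m, r * d) :=
  \matrix_(a, b) v (block_index b).1 (block_index b).2 a 0.

Lemma col_columns_mx v i k : col (mxvec_index i k) (columns_mx v) = v i k.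
Proof. by apply/matrixP => a b; rewrite !mxE block_indexK ord1. Qed.

(** The cofactors of the expansion along row [k0] of the determinants giving
    the entries of the wedges: they do not depend on the index in position
    [k0]. *)
Definition cofactor_mx (v : 'I_r -> 'I_d -> 'cV[F]_m) :
    'M[F]_(r * d, #|{: multi_index m d.-1}|) :=
  \matrix_(b, c) ((d`!%:R)^-1 * ((-1) ^+ (k0 + (block_index b).2) *
    \det (\matrix_(l, l') v (block_index b).1 (lift (block_index b).2 l')
             ((enum_val c : multi_index m d.-1) l) 0))).

Lemma flattening_sum_wedge v :
  flattening k0 (\sum_(i < r) wedge (v i)) = columns_mx v *m cofactor_mx v.
Proof.
apply/matrixP => a c; rewrite !mxE sum_ffunE big_mxvec_index.
apply: eq_bigr => i _.
rewrite wedgeE (expand_det_row _ k0) mulr_sumr; apply: eq_bigr => k _.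
rewrite !mxE !block_indexK /= ffunE unlift_none /= mulrCA; congr (_ * (_ * _)).
by congr (_ * \det _); apply/matrixP => l l'; rewrite !mxE ffunE liftK.
Qed.

Hypothesis d_gt1 : (1 < d)%N.
Hypothesis dF : d`!%:R != 0 :> F.
Hypothesis hm : (r * d <= m)%N.

Let basis_vector (i : 'I_r) (k : 'I_d) : 'cV[F]_m :=
  delta_mx (widen_ord hm (mxvec_index i k)) 0.

(** The wedges of disjoint groups of basis vectors.  The column of the
    flattening indexed by the vectors of a group with the vector k removed is a
    multiple of this vector. *)
Lemma flattening_full_rank_example :
  exists (v : 'I_r -> 'I_d -> 'cV[F]_m) (L : 'M_(r * d, m)) (R : 'M_(_, r * d)),
    L *m flattening k0 (\sum_(i < r) wedge (v i)) *m R = 1%:M.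
Proof.
pose cI (b : 'I_(r * d)) : multi_index m d.-1 :=
  [ffun l => widen_ord hm
    (mxvec_index (block_index b).1 (lift (block_index b).2 l))].
exists basis_vector, (columns_mx basis_vector)^T.
exists (\matrix_(c, b)
  (d`!%:R * ((-1) ^+ (k0 + (block_index b).2) * (enum_val c == cI b)%:R))).
rewrite flattening_sum_wedge mulmxA.
have -> : (columns_mx basis_vector)^T *m columns_mx basis_vector = 1%:M.
  apply/matrixP => b b'; rewrite !mxE (bigD1 (widen_ord hm b)) //= big1 => [|a ab].
    have [i [k ->]] := mxvec_index_surj b.
    have [j [l ->]] := mxvec_index_surj b'.
    rewrite !mxE !block_indexK /= !eqxx !andbT mul1r addr0.
    by rewrite -!val_eqE.
  rewrite !mxE; have [i [k bE]] := mxvec_index_surj b; rewrite bE block_indexK /=.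
  by rewrite -bE (negPf ab) mul0r.
rewrite mul1mx; apply/matrixP => b b'; rewrite !mxE (bigD1 (enum_rank (cI b'))) //=.
rewrite big1 ?addr0 => [|c cb]; last first.
  rewrite !mxE (_ : enum_val c == cI b' = false) ?mulr0 //.
  by apply: contraNF cb => /eqP <-; rewrite enum_valK.
rewrite !mxE enum_rankK eqxx mulr1.
have [i [k ->]] := mxvec_index_surj b; have [i' [k' ->]] := mxvec_index_surj b'.
rewrite !block_indexK /= mxvec_index_inj.
set D := \det _.
have -> : D = ((i == i') && (k == k'))%:R.
  have DE (l l' : 'I_d.-1) :
      basis_vector i (lift k l') (cI (mxvec_index i' k') l) 0 =
      ((i == i') && (lift k' l == lift k l'))%:R.
    rewrite ffunE block_indexK /= mxE eqxx andbT.
    have wE (x y : 'I_(r * d)) : (widen_ord hm x == widen_ord hm y) = (x == y).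
      by rewrite -val_eqE.
    rewrite wE mxvec_index_inj.
    by rewrite [i' == i]eq_sym.
  have zero_row (l : 'I_d.-1) :
      (forall l', (i == i') && (lift k' l == lift k l') = false) -> D = 0.
    move=> hl; rewrite /D (expand_det_row _ l) big1 // => l' _.
    by rewrite mxE DE hl mul0r.
  have [ii'|ii'] /= := eqVneq i i'; last first.
    have d0 : (0 < d.-1)%N by rewrite -ltnS prednK // ltnW.
    by apply: (zero_row (Ordinal d0)) => l'; rewrite (negPf ii').
  have [kk'|kk'] := eqVneq k k'; last first.
    have [l kE _] : {l | k = lift k' l & unlift k' k = Some l}.
      by apply: unlift_some; rewrite eq_sym.
    by apply: (zero_row l) => l'; rewrite -kE (negPf (neq_lift _ _)) andbF.
  rewrite -[RHS](det1 F d.-1); congr (\det _); apply/matrixP => l l'.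
  by rewrite [LHS]mxE [RHS]mxE DE ii' eqxx kk' (inj_eq lift_inj).
have [ii'|] /= := eqVneq i i'; last by rewrite !(mulr0n, mulr0, mul0r).
have [->|] /= := eqVneq k k'; last by rewrite !(mulr0n, mulr0, mul0r).
by rewrite mulr1n mulr1 mulrACA mulVf // mul1r -expr2 sqrr_sign.
Qed.

End Flattening.

Lemma map_wedge (F C : fieldType) (iota : {rmorphism F -> C}) m d
    (v : 'I_d -> 'cV[F]_m) :
  map_tensor iota (wedge v) = wedge (fun k => map_mx iota (v k)).
Proof.
apply/ffunP => i; rewrite ffunE !wedgeE rmorphM fmorphV rmorph_nat -det_map_mx.
by congr (_ * \det _); apply/matrixP => k l; rewrite !mxE.
Qed.

Lemma map_sum_wedge (F C : fieldType) (iota : {rmorphism F -> C}) m d r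
    (v : 'I_r -> 'I_d -> 'cV[F]_m) :
  map_tensor iota (\sum_(i < r) wedge (v i)) =
  \sum_(i < r) wedge (fun k => map_mx iota (v i k)).
Proof.
apply/ffunP => j; rewrite ffunE !sum_ffunE rmorph_sum; apply: eq_bigr => i _.
by rewrite -(map_wedge iota (v i)) [RHS]ffunE.
Qed.

Section Parametrization.
Variables (C : fieldType) (m d r : nat).

Definition param_dim := #|{: 'I_r * 'I_d * 'I_m}|.
Definition tensor_dim := #|{: multi_index m d}|.

(** [params] and [vectors_of] translate between families of vectors and points
    of the affine space that parametrizes them. *)
Definition params (v : 'I_r -> 'I_d -> 'cV[C]_m) (e : 'I_param_dim) : C :=
  let: (i, k, a) := enum_val e in v i k a 0.

Definition vectors_of (x : 'I_param_dim -> C) (i : 'I_r) (k : 'I_d) : 'cV[C]_m :=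
  \col_a x (enum_rank (i, k, a)).

Lemma vectors_ofK x : params (vectors_of x) =1 x.
Proof.
move=> e; rewrite /params; case E : (enum_val e) => [[i k] a].
by rewrite mxE -E enum_valK.
Qed.

Definition entries (T : tensor C m d) (e : 'I_tensor_dim) : C := T (enum_val e).

Lemma entries_inj T T' : entries T =1 entries T' -> T = T'.
Proof.
by move=> e; apply/ffunP => i; have := e (enum_rank i); rewrite /entries enum_rankK.
Qed.

Definition sum_wedge_poly (e : 'I_tensor_dim) : {mpoly C[param_dim]} :=
  \sum_(i < r) ((d`!%:R)^-1)%:MP *
    \det (\matrix_(k, l) 'X_(enum_rank (i, l, (enum_val e : multi_index m d) k))).

Lemma meval_sum_wedge_poly v e :
  (sum_wedge_poly e).@[params v] = entries (\sum_(i < r) wedge (v i)) e.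
Proof.
rewrite /entries sum_ffunE rmorph_sum; apply: eq_bigr => i _ /=.
rewrite wedgeE mevalM mevalC -det_map_mx; congr (_ * \det _).
by apply/matrixP => k l; rewrite !mxE /= mevalXU /params enum_rankK.
Qed.

End Parametrization.

(** * Generic tensors *)

(** Multiplying the flattening by the matrices that make it the identity for
    one particular sum and taking the determinant gives a polynomial in the
    entries of the tensor; it is nonzero at that sum, and wherever it is nonzero
    the rank is large. *)
Lemma full_rank_poly (C : numClosedFieldType) (m d r : nat) (k0 : 'I_d) :
  (1 < d)%N -> (r * d <= m)%N ->
  exists2 q : {mpoly C[tensor_dim m d]},
    q \mPo [tuple sum_wedge_poly C r e | e < tensor_dim m d] != 0 &
    forall T : tensor C m d,
      q.@[entries T] != 0 -> (r * d <= \rank (flattening k0 T))%N.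
Proof.
move=> d1 hm; have dC : d`!%:R != 0 :> C by rewrite pnatr_eq0 -lt0n fact_gt0.
have [v [L [R LR]]] := flattening_full_rank_example k0 d1 dC hm.
pose gflat : 'M[{mpoly C[tensor_dim m d]}]_(m, #|{: multi_index m d.-1}|) :=
  \matrix_(a, c) 'X_(enum_rank
    [ffun l => oapp (enum_val c : multi_index m d.-1) a (unlift k0 l)]).
pose q := \det (map_mx (@mpolyC _ C) L *m gflat *m map_mx (@mpolyC _ C) R).
have qE T : q.@[entries T] = \det (L *m flattening k0 T *m R).
  rewrite /q -det_map_mx !map_mxM -!map_mx_comp; congr (\det (_ *m _ *m _)).
  - by apply/matrixP => a b; rewrite !mxE /= mevalC.
  - by apply/matrixP => a b; rewrite !mxE /= mevalXU /entries enum_rankK.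
  - by apply/matrixP => a b; rewrite !mxE /= mevalC.
exists q.
  apply: contraTneq (oner_neq0 C) => q0; rewrite negbK.
  have := congr1 (meval (params v)) q0; rewrite meval0 comp_mpoly_meval.
  rewrite (meval_eq (v2 := entries (\sum_(i < r) wedge (v i)))) => [|e]; last first.
    by rewrite tnth_mktuple meval_sum_wedge_poly.
  by rewrite qE LR det1 => ->.
move=> T; rewrite qE => nz.
have /mxrank_unit <- : L *m flattening k0 T *m R \in unitmx.
  by rewrite unitmxE unitfE.
by rewrite (leq_trans (mxrankM_maxl _ _)) // mxrankM_maxr.
Qed.

Section Assembly.
Variables (R : realType) (F : fieldType).
Notation C := R[i].
Variables (cj : {rmorphism F -> F}) (iota : {rmorphism F -> C}).
Variables (re im : C -> F) (w : C).
Hypothesis reL : base_linear iota re.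
Hypothesis imL : base_linear iota im.
Hypothesis reim : forall z, z = iota (re z) + w * iota (im z).
Hypothesis cjK : involutive cj.
Hypothesis normalizable : forall m (v : 'rV[F]_m), v != 0 ->
  exists t, t * cj t * (v *m (map_mx cj v)^T) 0 0 = 1.

Variables (m d r : nat) (d_gt2 : (2 < d)%N) (hm : (d * r <= m)%N).
Let d_gt0 : (0 < d)%N := ltnW (ltnW d_gt2).

Lemma map_multilinear_mul (p : nat) (A : 'I_d -> 'M[F]_(p, m)) (T : tensor F m d) :
  map_tensor iota (multilinear_mul A T) =
  multilinear_mul (fun k => map_mx iota (A k)) (map_tensor iota T).
Proof.
apply/ffunP => i; rewrite !ffunE rmorph_sum; apply: eq_bigr => j _.
rewrite rmorphM rmorph_prod ffunE; congr (_ * _).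
by apply: eq_bigr => k _; rewrite mxE.
Qed.

Lemma map_flattening (k : 'I_d) (T : tensor F m d) :
  flattening k (map_tensor iota T) = map_mx iota (flattening k T).
Proof. by apply/matrixP => a c; rewrite !mxE ffunE. Qed.

Lemma orthonormal_basis_exists p n (B : 'M[F]_(m, p)) :
  \rank B = n -> exists U : 'M_(m, n), orthonormal_basis_of_columns cj B U.
Proof.
move=> rB; have [A Af AB] : exists2 A : 'M_(n, m), row_free A & (A == B^T)%MS.
  by rewrite -rB -mxrank_tr; exists (row_base B^T);
    [exact: row_base_free | apply/eqmxP/eq_row_base].
have [U UU UA] := gram_schmidt cjK (normalizable (m := m)) Af.
exists U^T; split; last first.
  by rewrite trmxK; apply/eqmxP/(eqmx_trans (eqmxP UA) (eqmxP AB)).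
rewrite /adjoint trmxK; have := congr1 trmx UU.
by rewrite trmx_mul trmxK trmx1.
Qed.

(** The bound on the rank forces the [r * d] vectors to be linearly independent,
    so they span the same space as the columns of the flattening, hence as those
    of [U]. *)
Lemma algorithm_decomposes_sum (T : tensor F m d) (v : 'I_r -> 'I_d -> 'cV[C]_m) :
  map_tensor iota T = \sum_(i < r) wedge (v i) ->
  (r * d <= \rank (flattening (Ordinal d_gt0) (map_tensor iota T)))%N ->
  @algorithm_decomposes R F cj iota m d r d_gt0 T.
Proof.
move=> Tv rkT; set T1 := flattening (Ordinal d_gt0) T.
pose V := columns_mx v.
have TV : map_mx iota T1 = V *m cofactor_mx (Ordinal d_gt0) v.
  by rewrite -map_flattening Tv flattening_sum_wedge.
have rkV : \rank V = (r * d)%N.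
  apply/eqP; rewrite eqn_leq rank_leq_col /= (leq_trans rkT) //.
  by rewrite map_flattening TV mxrankM_maxl.
have rkT1 : \rank T1 = (r * d)%N.
  rewrite -(mxrank_map iota); apply/eqP.
  rewrite eqn_leq -{2}map_flattening rkT andbT.
  by rewrite TV (leq_trans (mxrankM_maxl _ _)) ?rkV.
split; first exact: orthonormal_basis_exists.
move=> U [U1 /eqmxP UT].
have [G VG] : exists G, V = map_mx iota U *m G.
  have /submxP[G EG] : (V^T <= (map_mx iota U)^T)%MS.
    have TV' : (map_mx iota T1^T <= V^T)%MS.
      by rewrite -map_trmx TV trmx_mul submxMl.
    have -> : (V^T <= (map_mx iota U)^T)%MS = (V^T <= map_mx iota T1^T)%MS.
      have UTC : (map_mx iota U^T :=: map_mx iota T1^T)%MS.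
        by apply/eqmxP; rewrite !map_submx; apply/eqmxP.
      by rewrite map_trmx UTC.
    rewrite -(geq_leqif (mxrank_leqif_sup TV')).
    by rewrite mxrank_map !mxrank_tr rkT1 rkV.
  by exists G^T; rewrite -[V]trmxK EG trmx_mul trmxK.
have U1C : map_mx iota (adjoint cj U) *m map_mx iota U = 1%:M.
  by rewrite -map_mxM U1 map_mx1.
have Gu : G \in unitmx.
  rewrite -row_full_unit /row_full -[_ == _]andTb; apply/eqP/anti_leq.
  by rewrite rank_leq_col /= -[X in (X <= _)%N]rkV VG mxrankM_maxr.
have UG i k : map_mx iota U *m block_col G i k = v i k.
  by rewrite /block_col colE mulmxA -VG -colE col_columns_mx.
have AE : map_tensor iota (compress cj U T) = \sum_(i < r) wedge (block_col G i).
  rewrite /compress map_multilinear_mul Tv linear_sum; apply: eq_bigr => i _ /=.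
  rewrite multilinear_mul_wedge; apply: eq_wedge => k.
  by rewrite -UG mulmxA U1C mul1mx.
apply: (kernel_steps_decompose reL imL reim d_gt2 Gu AE
  (Q := fun v x => map_tensor iota T =
     \sum_(i < r) x i *: wedge (fun k => map_mx iota U *m v i k))).
move=> v' x sx.
have -> : map_tensor iota T =
    multilinear_mul (fun=> map_mx iota U) (map_tensor iota (compress cj U T)).
  rewrite AE Tv linear_sum; apply: eq_bigr => i _ /=.
  by rewrite multilinear_mul_wedge; apply: eq_wedge => k; rewrite UG.
rewrite -sx linear_sum; apply: eq_bigr => i _.
by rewrite linearZ /= multilinear_mul_wedge.
Qed.

(** The closed set to avoid is the zero set of the product of two polynomials:
    one outside of which the elements of the complex closure are sums, the other
    one outside of which the flattening has maximal rank.  A complex polynomial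
    vanishing on all complex sums vanishes on the closure over [F] of the sums
    over [F], so that elements of the latter lie in the complex closure. *)
Theorem algorithm_decomposes_generically :
  generically (@grassmann_variety F m d r)
    (@algorithm_decomposes R F cj iota m d r d_gt0).
Proof.
have [q1 q1nz hq1] :=
  image_contains_open_of_closure (@sum_wedge_poly C m d r).
have hm' : (r * d <= m)%N by rewrite mulnC.
have [q2 q2nz hq2] := @full_rank_poly C m d r (Ordinal d_gt0) (ltnW d_gt2) hm'.
pose ev (T : tensor F m d) (e : 'I_(tensor_dim m d)) : C := iota (entries T e).
have evE T : ev T =1 entries (map_tensor iota T).
  by move=> e; rewrite /ev /entries ffunE.
have closed (p : {mpoly C[tensor_dim m d]}) :
    zariski_closed (fun T : tensor F m d => p.@[ev T] = 0).
  apply: (zero_set_closed reL imL reim) => e T.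
  rewrite {1}(coord_vbasis (memvf T)) /entries sum_ffunE.
  by apply: eq_bigr => k _; rewrite ffunE.
have pull (p : {mpoly C[tensor_dim m d]}) (v : 'I_r -> 'I_d -> 'cV[F]_m) :
    p.@[ev (\sum_(i < r) wedge (v i))] =
    (p \mPo [tuple sum_wedge_poly C r e | e < tensor_dim m d]).@[
      params (fun i k => map_mx iota (v i k))].
  rewrite comp_mpoly_meval; apply: meval_eq => e.
  by rewrite tnth_mktuple meval_sum_wedge_poly evE map_sum_wedge.
exists (fun T => (q1 * q2).@[ev T] = 0); split; first exact: closed.
- have q12 : (q1 * q2) \mPo [tuple sum_wedge_poly C r e | e < tensor_dim m d] != 0.
    exact: (comp_mpolyM_neq0 q1nz q2nz).
  have [a qa] := mpoly_nat_nonroot q12.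
  pose v := vectors_of (fun e => (a e)%:R : F).
  exists (\sum_(i < r) wedge (v i)); split.
    by move=> Z _; apply; exists v.
  rewrite pull => e; case/eqP: qa; rewrite -[RHS]e; apply: meval_eq => j.
  rewrite /params; case E : (enum_val j) => [[i k] b].
  by rewrite !mxE -E enum_valK rmorph_nat.
- move=> T XT; rewrite mevalM => /eqP; rewrite mulf_eq0 negb_or => /andP[q1T q2T].
  have [|//|x hx] := hq1 (ev T).
    move=> p p0; apply: (XT _ (closed p)) => _ [v ->].
    by rewrite pull p0 meval0.
  apply: (algorithm_decomposes_sum (v := vectors_of x)).
    apply: entries_inj => e; rewrite -evE hx -meval_sum_wedge_poly.
    by apply: meval_eq => j; rewrite vectors_ofK.
  by apply: hq2; rewrite -(meval_eq _ (evE T)).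
Qed.

End Assembly.

Theorem theorem4p10 (R : realType) (m d r : nat)
    (hd : (2 < d)%N) (hm : (d * r <= m)%N) :
  generically (@grassmann_variety R m d r)
    (@algorithm_decomposes R R id (real_complex R) m d r (ltnW (ltnW hd)))
  /\
  generically (@grassmann_variety R[i] m d r)
    (@algorithm_decomposes R R[i] Num.conj id m d r (ltnW (ltnW hd))).
Proof.
split.
- apply: (@algorithm_decomposes_generically R R idfun (real_complex R)
    (@complex.Re R) (@complex.Im R) (Complex 0 1)) => //.
  + by move=> a [x y] [x' y'] /=; rewrite mul0r subr0.
  + by move=> a [x y] [x' y'] /=; rewrite mul0r addr0.
  + exact: complexE.
  + move=> n v v0.
    have s0 : 0 < (v *m (map_mx idfun v)^T) 0 0.
      by apply: hermitian_norm_gt0 v0 => x; rewrite real_normK ?num_real.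
    exists (Num.sqrt ((v *m (map_mx idfun v)^T) 0 0))^-1.
    rewrite -invfM -expr2 sqr_sqrtr ?ltW // mulVf ?gt_eqF //.
(* Over the complex numbers, a number is its own single component. *)
- apply: (@algorithm_decomposes_generically R R[i] Num.conj idfun id (fun=> 0) 0) => //.
  + by move=> a z z'; rewrite mulr0 addr0.
  + by move=> z; rewrite mul0r addr0.
  + exact: conjCK.
  + move=> n v v0; set s := (v *m _) 0 0.
    have s0 : 0 < s by apply: hermitian_norm_gt0 v0 => x; rewrite normCK.
    exists (sqrtC s)^-1; rewrite /= geC0_conj ?invr_ge0 ?sqrtC_ge0 ?ltW //.
    by rewrite -invfM -expr2 sqrtCK mulVf ?gt_eqF.
Qed.
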